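(* Let $m\ge l>k$ and $L\ge2$ be integers, and assume $L>2$ if $m<2l$. Let $E$ be an $m\times k$ random matrix with independent $\mathcal N(0,1)$ entries. Then for any $\eta$ with $0<\eta<1-\frac{1}{\lfloor m/l\rfloor(L-1)}$, $$\mathscr D_{\mathrm a}(E,L)<16e\,m^{3/2}l^{-1}L^{-(1-\eta)\lfloor m/l\rfloor}$$ with probability at least $$1-e^{l/2}\Big(10+8\sqrt{\eta\lfloor m/l\rfloor\log L}\Big)^k e^{\frac{\eta}{1-\eta}(l-k)}L^{-\eta\lfloor m/l\rfloor(l-k)}-e^{-2m}.$$
   Context: For a $k\times m$ matrix $F$, finite $\mathscr A\subset\mathbb{R}$ and bounded $\mathscr X\subset\mathbb{R}^k$, $\mathscr D_{\mathrm s}(F,\mathscr A,\mathscr X):=\sup_{x\in\mathscr X}\inf_{q\in\mathscr A^m}\|x-Fq\|_2$; for an $m\times k$ matrix $E$, $\mathscr D_{\mathrm a}(E,\mathscr A,\mathscr X):=\inf\{\mathscr D_{\mathrm s}(F,\mathscr A,\mathscr X):FE=I_k\}$ (infimum over empty set is $+\infty$); and $\mathscr D_{\mathrm a}(E,L):=\inf_{|\mathscr A|=L}\mathscr D_{\mathrm a}(E,\mathscr A,B_1)$ with $B_1$ the closed unit Euclidean ball of $\mathbb{R}^k$. *)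

(* Defs.v *)
From HB Require Import structures.
From mathcomp Require Import all_boot all_order all_algebra.
From mathcomp Require Import all_classical all_reals all_analysis.
Set Implicit Arguments. Unset Strict Implicit. Unset Printing Implicit Defensive.
Import Order.TTheory GRing.Theory Num.Theory.
Local Open Scope classical_set_scope.
Local Open Scope ring_scope.

Definition enorm {R : realType} {k : nat} (x : 'cV[R]_k) : R :=
  Num.sqrt (\sum_(i < k) x i 0 ^+ 2).

Definition unit_ball {R : realType} (k : nat) : set 'cV[R]_k :=
  [set x | enorm x <= 1].

(* A^m, with the finite alphabet A given as a duplicate-free list *)
Definition alph_vecs {R : realType} (m : nat) (A : seq R) : set 'cV[R]_m :=
  [set q | forall i, q i 0 \in A].

Definition Ds {R : realType} {k m : nat} (F : 'M[R]_(k, m)) (A : seq R)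
    (X : set 'cV[R]_k) : \bar R :=
  ereal_sup ((fun x => ereal_inf ((fun q => (enorm (x - F *m q))%:E) @` @alph_vecs R m A)) @` X).

(* D_a(E, A, X) = inf { D_s(F, A, X) : F E = I_k }  (inf of empty set = +oo) *)
Definition Da_A {R : realType} {m k : nat} (E : 'M[R]_(m, k)) (A : seq R)
    (X : set 'cV[R]_k) : \bar R :=
  ereal_inf ((fun F => Ds F A X) @` [set F : 'M[R]_(k, m) | F *m E = 1%:M]).

Definition Da {R : realType} {m k : nat} (E : 'M[R]_(m, k)) (L : nat) : \bar R :=
  ereal_inf ((fun A => Da_A E A (@unit_ball R k)) @` [set A : seq R | uniq A /\ size A = L]).

(* A finite family of real random variables, each N(0,1)-distributed and
   mutually independent (product rule over the whole finite family; taking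
   B p = setT recovers every subfamily). *)
Definition iid_std_gaussian {R : realType} {d : measure_display}
    {T : measurableType d} (P : probability T R) {I : finType}
    (X : I -> T -> R) : Prop :=
  (forall p, measurable_fun setT (X p)) /\
  (forall p (B : set R), measurable B -> P (X p @^-1` B) = normal_prob 0 1 B) /\
  (forall B : I -> set R, (forall p, measurable (B p)) ->
     P (\bigcap_(p in [set: I]) (X p @^-1` B p)) =
     (\prod_(p : I) P (X p @^-1` B p))%E).

(* Main.v *)
(** The frame vectors are grouped into l blocks of p = floor (m / l) consecutive
    rows. Within a block a greedy beta-expansion, beta = L p / (p + 1), chooses
    q so that the weighted sums sum_j beta^-j (y_j - q_j) are of size
    beta^(1-p); these sums, normalized, are the entries of V (y - q), where V
    is an l x m matrix with orthonormal, disjointly supported rows. The dual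
    F = (V E)^+ V then has reconstruction error |V (y - q)| / sigma_min (V E).
    The l x k matrix V E is again standard Gaussian, and its least singular
    value is bounded below by a net argument. All probability estimates reduce
    to exponential moments of Gaussian quadratic forms, and a single Markov
    inequality, applied to the sum of all the exponentials involved, plays the
    role of the union bound. *)

Require Import Defs.
From HB Require Import structures.
From mathcomp Require Import all_boot all_order all_algebra archimedean.
From mathcomp Require Import zify ring lra.
From mathcomp Require Import all_classical all_reals all_analysis.
From mathcomp Require Import measurable_realfun.
Import Order.TTheory GRing.Theory Num.Theory.
Import numFieldNormedType.Exports.
Local Open Scope classical_set_scope.
Local Open Scope ring_scope.

Set Implicit Arguments. Unset Strict Implicit. Unset Printing Implicit Defensive.

(** * Euclidean norm and nets *)

(** Everything is governed by t = eta p log L. The least singular value is only asked to exceed a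
    multiple of e^-t sqrt l. This costs a factor e^t = L^(eta p) in the distortion and makes the
    failure probability of order e^(-t (l - k)): a small-ball probability e^(-t l) for each point,
    against about e^(t k) points of a net of mesh of order e^-t. To keep the chance of a larger
    operator norm below e^(-t l), the bound on that norm must grow like sqrt (t l), so the mesh is
    really e^-t / sqrt t; hence the sqrt t in the base 10 + 8 sqrt t, which leaves little slack in
    the constants. The 16 is 3 / (3/16): 3 sqrt m bounds the rows of E, and 3/16 e^-t sqrt l the
    singular value. The alphabet depends on m, l and L only, not on E. The law of V E is never
    formed; only exponential moments of |V E y|^2 at fixed y are computed. Defining the good event
    by the sum of exponentials also makes it visibly measurable. *)

Lemma enorm_sqr (R : realType) (k : nat) (x : 'cV[R]_k) :
  enorm x ^+ 2 = \sum_(i < k) x i 0 ^+ 2.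
Proof. by rewrite sqr_sqrtr// sumr_ge0// => i _; exact: sqr_ge0. Qed.

Section euclidean_norm.
Context (R : realType) (k : nat).
Implicit Types x y : 'cV[R]_k.

Lemma enorm_ge0 x : 0 <= enorm x. Proof. exact: sqrtr_ge0. Qed.

Lemma enormZ (a : R) x : enorm (a *: x) = `|a| * enorm x.
Proof.
rewrite -sqrtr_sqr /enorm -sqrtrM ?sqr_ge0// mulr_sumr; congr Num.sqrt.
by apply: eq_bigr => i _; rewrite mxE exprMn.
Qed.

Lemma enormN x : enorm (- x) = enorm x.
Proof. by rewrite -scaleN1r enormZ normrN1 mul1r. Qed.

Lemma enorm0 : enorm (0 : 'cV[R]_k) = 0.
Proof. by rewrite -(scale0r 0) enormZ normr0 mul0r. Qed.

Lemma enorm_eq0 x : (enorm x == 0) = (x == 0).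
Proof.
apply/eqP/eqP => [x0|->]; last exact: enorm0.
have /eqP := enorm_sqr x; rewrite x0 expr0n eq_sym psumr_eq0 => [/allP H|i _].
  apply/matrixP => i j; rewrite ord1 mxE.
  by apply/eqP; have := H i (mem_index_enum _); rewrite sqrf_eq0.
exact: sqr_ge0.
Qed.

Lemma cauchy_schwarz x y :
  \sum_i x i 0 * y i 0 <= enorm x * enorm y.
Proof.
have [->|x0] := eqVneq x 0.
  by rewrite enorm0 mul0r big1// => i _; rewrite mxE mul0r.
have [->|y0] := eqVneq y 0.
  by rewrite enorm0 mulr0 big1// => i _; rewrite mxE mulr0.
have nx : 0 < enorm x by rewrite lt_def enorm_eq0 x0 enorm_ge0.
have ny : 0 < enorm y by rewrite lt_def enorm_eq0 y0 enorm_ge0.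
(* This weight makes both halves of 2 a b <= s a^2 + s^-1 b^2 sum to |x| |y|. *)
pose s := enorm y / enorm x.
have s0 : 0 < s by rewrite divr_gt0.
have : \sum_i x i 0 * y i 0 <=
    \sum_i (s * x i 0 ^+ 2 + s^-1 * y i 0 ^+ 2) / 2.
  apply: ler_sum => i _; rewrite ler_pdivlMr// -subr_ge0.
  have -> : s * x i 0 ^+ 2 + s^-1 * y i 0 ^+ 2 - x i 0 * y i 0 * 2 =
    s^-1 * (s * x i 0 - y i 0) ^+ 2 by field; rewrite gt_eqF.
  by rewrite mulr_ge0 ?sqr_ge0// invr_ge0 ltW.
rewrite -mulr_suml big_split/= -!mulr_sumr -!enorm_sqr => /le_trans; apply.
by rewrite /s le_eqVlt; apply/orP; left; apply/eqP; field; rewrite !gt_eqF.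
Qed.

Lemma enormD x y : enorm (x + y) <= enorm x + enorm y.
Proof.
rewrite -(ler_pXn2r (ltn0Sn 1)) ?nnegrE ?addr_ge0 ?enorm_ge0//.
rewrite enorm_sqr sqrrD !enorm_sqr.
under eq_bigr do rewrite mxE sqrrD.
rewrite !big_split/= lerD2r lerD2l.
by rewrite -mulr2n lerMn2r cauchy_schwarz.
Qed.

Lemma ler_enormB x y : enorm x - enorm y <= enorm (x - y).
Proof. by rewrite lerBlDr -{1}(subrK y x) enormD. Qed.

Lemma abs_coord_le x i : `|x i 0| <= enorm x.
Proof.
rewrite -(ler_pXn2r (ltn0Sn 1)) ?nnegrE ?enorm_ge0// enorm_sqr real_normK ?num_real//.
by rewrite (bigD1 i)//= lerDl sumr_ge0// => j _; exact: sqr_ge0.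
Qed.

End euclidean_norm.

Lemma expR_ge_quadratic (R : realType) (x : R) : 0 <= x ->
  1 + x + x ^+ 2 / 2 <= expR x.
Proof.
move=> x0.
have -> : 1 + x + x ^+ 2 / 2 = series (exp_coeff x) 3.
  rewrite /series/= !big_nat_recr//= big_nil /exp_coeff/= add0r.
  by rewrite expr0 expr1 !fact0 invr1 ?fact1 ?invr1 !mulr1.
apply: nondecreasing_cvgn_le; last exact: is_cvg_series_exp_coeff.
apply: nondecreasing_series => i _ _.
by rewrite /exp_coeff divr_ge0// exprn_ge0.
Qed.

(** The right-hand side is the sum of q^|j| over all integers j; the shift by [n] lets ordinals
    index the integers from -n to n. *)
Lemma sum_geometric_sym (R : realType) (q : R) (n : nat) : 0 <= q -> q < 1 ->
  \sum_(j < n.*2.+1) q ^+ `|j - n|%N <= (1 + q) / (1 - q).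
Proof.
move=> q0 q1; rewrite ler_pdivlMr ?subr_gt0//.
have geo N : (\sum_(j < N) q ^+ j) * (1 - q) = 1 - q ^+ N.
  by rewrite -[RHS]opprB subrX1 -mulNr opprB mulrC.
have -> : \sum_(j < n.*2.+1) q ^+ `|j - n|%N =
    \sum_(j < n) q ^+ j.+1 + \sum_(j < n.+1) q ^+ j.
  rewrite -(big_mkord xpredT (fun j => q ^+ `|j - n|%N)).
  rewrite (@big_cat_nat _ _ _ n)//=; last by rewrite -addnn leqW// leq_addr.
  congr (_ + _).
    rewrite big_nat_rev/= add0n big_mkord; apply: eq_bigr => j _.
    congr (_ ^+ _); have := ltn_ord j; lia.
  rewrite -{1}[n]add0n big_addn (_ : _ - n = n.+1)%N; last by lia.
  rewrite big_mkord; apply: eq_bigr => j _; congr (_ ^+ _); lia.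
rewrite mulrDl geo; under eq_bigr do rewrite exprS.
rewrite -mulr_sumr -mulrA geo.
have : 0 <= q ^+ n.+1 by exact: exprn_ge0.
by rewrite exprS; nra.
Qed.

Lemma natr_distn (R : realType) (a b : nat) :
  (`|a - b|%N)%:R = `|a%:R - b%:R| :> R.
Proof.
have [ab|ba] := leqP a b.
  by rewrite distnEr// natrB// distrC ger0_norm// subr_ge0 ler_nat.
by rewrite distnEl ?natrB ?(ltnW ba)// ger0_norm// subr_ge0 ler_nat ltnW.
Qed.

(* The net consists of the points of norm at most 1 + eps of the lattice of
   mesh 2 eps / sqrt k, onto which the ball is rounded coordinatewise. Such a
   point h z satisfies sum_i |z_i| <= k K, K = (1 + eps) / (2 eps), so that
   there are at most (e * sum_j exp (- |j| / K)) ^ k of them. *)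
Lemma euclidean_net (R : realType) (k : nat) (eps : R) :
  (0 < k)%N -> 0 < eps ->
  exists N : seq 'cV[R]_k,
    [/\ forall x, enorm x <= 1 -> exists2 y, y \in N & enorm (x - y) <= eps,
        forall y, y \in N -> enorm y <= 1 + eps &
        (size N)%:R <= (expR 1 * (eps^-1 + 1 + eps)) ^+ k].
Proof.
move=> k0 e0; have kR : 0 < k%:R :> R by rewrite ltr0n.
have sk : Num.sqrt k%:R ^+ 2 = k%:R :> R by rewrite sqr_sqrtr// ltW.
have sk0 : 0 < Num.sqrt k%:R :> R by rewrite sqrtr_gt0.
pose h : R := 2 * eps / Num.sqrt k%:R.
have h0 : 0 < h by rewrite divr_gt0// mulr_gt0.
have h2 : h ^+ 2 * k%:R = 4 * eps ^+ 2.
  by rewrite -sk /h; field; rewrite gt_eqF.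
(* In the ball |x_i| <= 1, so the lattice coordinates x_i / h have modulus below [n]. *)
pose n := Num.bound h^-1.
have nh : h^-1 < n%:R by rewrite archi_boundP// invr_ge0 ltW.
pose th : R := 2 * eps / (1 + eps).
have th0 : 0 < th by rewrite divr_gt0 ?mulr_gt0 ?addr_gt0.
pose pt (z : {ffun 'I_k -> 'I_n.*2.+1}) : 'cV[R]_k :=
  \col_i (h * ((z i)%:R - n%:R)).
pose A := [pred z | enorm (pt z) <= 1 + eps].
exists [seq pt z | z <- enum A]; split.
- move=> x x1.
  (* The summand 1/2 turns truncation into rounding to the nearest lattice point, with error at most
     h / 2 in each coordinate. *)
  pose u i : R := x i 0 / h + n%:R + 2^-1.
  have xh i : `|x i 0 / h| < n%:R.
    rewrite normrM (gtr0_norm (_ : 0 < h^-1)) ?invr_gt0//.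
    apply: le_lt_trans nh; rewrite ler_piMl ?invr_ge0 ?(ltW h0)//.
    exact: le_trans (abs_coord_le _ _) x1.
  have ui i : 0 <= u i < n.*2.+1%:R.
    have -> : n.*2.+1%:R = n%:R + n%:R + 1 :> R by rewrite -addn1 -addnn !natrD.
    have := xh i; rewrite ltr_norml /u => /andP[? ?].
    by apply/andP; split; lra.
  have ti i : (Num.truncn (u i) < n.*2.+1)%N.
    have /andP[u0 ult] := ui i.
    rewrite -(ltr_nat R); apply: le_lt_trans ult.
    by have /andP[] := truncn_itv u0.
  pose z := [ffun i => Ordinal (ti i)].
  have zi : enorm (x - pt z) <= eps.
    have hh : 0 <= h / 2 by rewrite ltW// divr_gt0.
    rewrite -(ler_pXn2r (ltn0Sn 1)) ?nnegrE ?enorm_ge0 ?(ltW e0)//.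
    rewrite enorm_sqr (@le_trans _ _ (\sum_(i < k) (h / 2) ^+ 2))//.
      apply: ler_sum => i _; rewrite !mxE ffunE /=.
      have /andP[u0 _] := ui i; have /andP[t1 t2] := truncn_itv u0.
      rewrite -[leLHS](real_normK (num_real _)) ler_pXn2r ?nnegrE//.
      have -> : x i 0 - h * ((Num.truncn (u i))%:R - n%:R) =
          h * (u i - (Num.truncn (u i))%:R - 2^-1).
        by rewrite /u; field; rewrite gt_eqF.
      rewrite normrM gtr0_norm// ler_pM2l// ler_norml.
      by move: t2; rewrite -addn1 natrD => t2; apply/andP; split; lra.
        rewrite sumr_const card_ord -[leLHS]mulr_natr exprMn mulrAC h2.
    by rewrite le_eqVlt; apply/orP; left; apply/eqP; field.
  exists (pt z) => //; apply/mapP; exists z => //; rewrite mem_enum inE/=.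
  rewrite -[pt z](subrK x) addrC (le_trans (enormD _ _))//.
  by rewrite lerD// -enormN opprB.
- by move=> y /mapP[z]; rewrite mem_enum inE /= => zA ->.
rewrite size_map -cardE.
pose q := expR (- th).
have q0 : 0 <= q by exact: expR_ge0.
have q1 : q < 1 by rewrite expR_lt1 oppr_lt0.
pose F (j : 'I_n.*2.+1) : R := expR 1 * q ^+ `|j - n|%N.
have F0 j : 0 <= F j by rewrite mulr_ge0 ?expR_ge0// exprn_ge0.
(* Each point of the net contributes at least 1 to this sum, since th |u| <= (th^2 u^2 + 1) / 2
   gives th sum_i |z_i - n| <= k; and the sum factors over the coordinates. *)
apply: (@le_trans _ _ (\sum_(z : {ffun 'I_k -> 'I_n.*2.+1}) \prod_i F (z i))).
  rewrite -sum1_card natr_sum [leRHS](bigID A)/= -[leLHS]addr0 lerD//; last first.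
    by apply: sumr_ge0 => z _; apply: prodr_ge0 => i _.
  apply: ler_sum => z zA.
  have -> : \prod_i F (z i) = expR (\sum_i (1 - th * `|(z i)%:R - n%:R|)).
    rewrite expR_sum; apply: eq_bigr => i _.
    by rewrite /F /q -expRM_natr natr_distn mulNr expRD.
  rewrite -[leLHS](@expR0 R) ler_expR sumrB sumr_const card_ord subr_ge0.
  have H : enorm (pt z) <= 1 + eps by [].
  have {}H : h ^+ 2 * \sum_i ((z i)%:R - n%:R) ^+ 2 <= (1 + eps) ^+ 2.
    rewrite mulr_sumr; under eq_bigr do rewrite -exprMn.
    have -> : \sum_(i < k) (h * ((z i)%:R - n%:R)) ^+ 2 = enorm (pt z) ^+ 2.
      by rewrite enorm_sqr; apply: eq_bigr => i _; rewrite mxE.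
    by rewrite ler_pXn2r// nnegrE ?enorm_ge0// addr_ge0// ltW.
  apply: (@le_trans _ _
    (\sum_i (th ^+ 2 * ((z i)%:R - n%:R) ^+ 2 + 1) / 2)).
    apply: ler_sum => i _; rewrite ler_pdivlMr//.
    rewrite -(real_normK (num_real ((z i)%:R - n%:R))) -exprMn.
    by have := sqr_ge0 (th * `|(z i)%:R - n%:R| - 1); nra.
  rewrite -mulr_suml big_split/= sumr_const card_ord -mulr_sumr ler_pdivrMr//.
  rewrite mulr_natr mulr2n lerD2r.
  rewrite -(ler_pM2l (exprn_gt0 2 h0)) h2 mulrCA.
  apply: le_trans (ler_wpM2l (sqr_ge0 _) H) _.
  by rewrite /th le_eqVlt; apply/orP; left; apply/eqP; field; rewrite gt_eqF// addr_gt0.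
rewrite -(bigA_distr_bigA (fun _ : 'I_k => F))/= prodr_const card_ord.
rewrite ler_pXn2r ?nnegrE ?sumr_ge0//; last first.
  by rewrite mulr_ge0 ?expR_ge0 ?addr_ge0 ?invr_ge0 ?(ltW e0).
rewrite -mulr_sumr ler_pM2l ?expR_gt0//.
apply: le_trans (sum_geometric_sym n q0 q1) _.
rewrite ler_pdivrMr ?subr_gt0//.
(* The second-order term matters: e^th >= 1 + th alone would not give the inequality below for eps <
   1. *)
have : q * (1 + th + th ^+ 2 / 2) <= 1.
  rewrite /q expRN ler_pdivrMl ?expR_gt0// mulr1.
  by apply: expR_ge_quadratic; exact: ltW.
rewrite -ler_pdivlMr; last by rewrite !addr_gt0// divr_gt0// exprn_gt0.
rewrite mul1r => qle.
suff : q * (eps^-1 + 2 + eps) <= eps^-1 + eps by nra.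
apply: le_trans (ler_wpM2r _ qle) _; first by rewrite !addr_ge0 ?invr_ge0 ?ltW.
rewrite /th -subr_ge0.
set t := (X in 0 <= X).
have e2 : 0 < 1 + 4 * eps + 5 * eps ^+ 2 by nra.
have -> : t = 4 * eps ^+ 3 / (1 + 4 * eps + 5 * eps ^+ 2).
  by rewrite /t; field; rewrite !gt_eqF// addr_gt0.
by rewrite divr_ge0 ?mulr_ge0 ?exprn_ge0// ltW.
Qed.

(** * Gaussian moments *)

(** The Radon-Nikodym derivative of the normal law and [normal_pdf] have the same integral over
    every measurable set, hence agree almost everywhere. *)
Lemma integral_normal_prob (R : realType) (f : R -> \bar R) :
  measurable_fun setT f -> (forall x, (0 <= f x)%E) ->
  (\int[normal_prob 0 1]_x f x =
   \int[lebesgue_measure]_x (f x * (normal_pdf 0 1 x)%:E))%E.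
Proof.
move=> mf f0.
pose nu : {finite_measure set _ -> \bar R} := normal_prob (0 : R) 1.
have dom : nu `<< (@lebesgue_measure R) by exact: normal_prob_dominates.
rewrite -(Radon_Nikodym_SigmaFinite.change_of_variables dom)//.
have mpdf : measurable_fun setT (fun x : R => (normal_pdf 0 1 x)%:E).
  by apply/measurable_EFinP; exact: measurable_normal_pdf.
have mrn : measurable_fun setT (Radon_Nikodym_SigmaFinite.f nu (@lebesgue_measure R)).
  exact: measurable_int (Radon_Nikodym_SigmaFinite.f_integrable dom).
apply: ae_eq_integral => //.
- exact: emeasurable_funM.
- exact: emeasurable_funM.
apply: ae_eqe_mul2l; apply: integral_ae_eq => //.
- exact: Radon_Nikodym_SigmaFinite.f_integrable.
- by move=> E _ mE; rewrite -Radon_Nikodym_SigmaFinite.f_integral.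
Qed.

(** Completing the square: with v = 1 + 2 lam a^2, lam (c + a x)^2 + x^2 / 2 = v (x - mm)^2 / 2 +
    lam c^2 / v, so the integrand is a multiple of the normal density of mean [mm] and variance 1 /
    v. Negative [lam] is allowed while v > 0. *)
Lemma gauss_expR_sqr (R : realType) (lam a c : R) :
  0 < 1 + 2 * lam * a ^+ 2 ->
  (\int[normal_prob 0 1]_x (expR (- (lam * (c + a * x) ^+ 2)))%:E =
   ((Num.sqrt (1 + 2 * lam * a ^+ 2))^-1 *
    expR (- (lam / (1 + 2 * lam * a ^+ 2) * c ^+ 2)))%:E)%E.
Proof.
set v := 1 + _ => v0.
rewrite integral_normal_prob; last 2 first.
- apply/measurable_EFinP; apply: measurableT_comp => //.
  apply: measurableT_comp => //; apply: measurable_funM => //.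
  apply: measurable_funX; apply: measurable_funD => //.
- by move=> x; rewrite lee_fin expR_ge0.
have sv0 : 0 < Num.sqrt v by rewrite sqrtr_gt0.
have svi : (Num.sqrt v)^-1 != 0 by rewrite gt_eqF// invr_gt0.
have vE : Num.sqrt v ^+ 2 = v by rewrite sqr_sqrtr// ltW.
pose mm := - (2 * lam * a * c / v).
rewrite -[RHS]mule1 -(integral_normal_pdf mm (Num.sqrt v)^-1).
have k0 : 0 <= (Num.sqrt v)^-1 * expR (- (lam / v * c ^+ 2)).
  by rewrite mulr_ge0 ?expR_ge0// invr_ge0 ltW.
rewrite -(ge0_integralZl_EFin _ _ _ _ k0); first last.
- by apply/measurable_EFinP; exact: measurable_normal_pdf.
- by move=> x _; rewrite lee_fin normal_pdf_ge0.
- by [].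
apply: eq_integral => x _; rewrite -!EFinM; congr EFin.
rewrite !normal_pdfE ?oner_eq0//; rewrite /normal_peak /normal_fun.
rewrite expr1n exprVn vE -[v^-1 * pi *+ 2]mulrnAr sqrtrM ?invr_ge0 ?ltW//.
rewrite sqrtrV ?ltW// invfM invrK mul1r.
transitivity ((Num.sqrt (pi *+ 2))^-1 * (expR (- (lam / v * c ^+ 2)) *
  expR (- (x - mm) ^+ 2 / (v^-1 *+ 2)))); last first.
  by field; rewrite !gt_eqF// sqrtr_gt0 mulrn_wgt0// pi_gt0.
rewrite mulrCA -!expRD; congr (_ * expR _); rewrite /mm -[v^-1 *+ 2]mulr_natr.
have vn : 1 + 2 * lam * a ^+ 2 != 0 by rewrite gt_eqF.
by rewrite /v; field.
Qed.

Lemma measurable_sum_seq (R : realType) (d : measure_display)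
    (T : measurableType d) (I : eqType) (J : seq I) (Q : pred I)
    (h : I -> T -> R) :
  (forall q, q \in J -> measurable_fun setT (h q)) ->
  measurable_fun setT (fun w => \sum_(q <- J | Q q) h q w).
Proof.
elim: J => [_|q J IH mh].
  by under eq_fun do rewrite big_nil; exact: measurable_cst.
under eq_fun do rewrite big_cons.
have mJ : measurable_fun setT (fun w => \sum_(q <- J | Q q) h q w).
  by apply: IH => q' q'J; apply: mh; rewrite inE q'J orbT.
case: (Q q); last exact: mJ.
by apply: measurable_funD; [apply: mh; rewrite inE eqxx|exact: mJ].
Qed.

(** * Independence and integration of one variable at a time *)

Section resampling.
Context (R : realType) (d : measure_display) (T : measurableType d).
Context (P : probability T R) (I : finType) (X : I -> T -> R).
Hypothesis iidX : iid_std_gaussian P X.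

(** A pi-system generating the sigma-algebra of the variables other than [X p], kept on [T] itself
    so that functions of these variables remain functions of the sample point. *)
Definition other_boxes (p : I) : set (set T) :=
  [set A | exists B : I -> set R, [/\ forall q, measurable (B q), B p = setT &
     A = \bigcap_(q in [set: I]) (X q @^-1` B q)]].

Let mX q : measurable_fun setT (X q). Proof. by have [] := iidX. Qed.

Let mXpre q (B : set R) : measurable B -> measurable (X q @^-1` B).
Proof. by move=> mB; rewrite -[_ @^-1` _]setTI; exact: mX. Qed.

Let mbox (B : I -> set R) : (forall q, measurable (B q)) ->
  measurable (\bigcap_(q in [set: I]) (X q @^-1` B q)).
Proof.
move=> mB; apply: fin_bigcap_measurable => [|q _]; last exact: mXpre.
exact: finite_finset.
Qed.

Let other_boxes_measurable p : other_boxes p `<=` measurable.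
Proof. by move=> _ [B [mB _ ->]]; exact: mbox. Qed.

Let sother p : <<s other_boxes p >> `<=` measurable.
Proof.
exact: (smallest_sub (@sigma_algebra_measurable _ T) (@other_boxes_measurable p)).
Qed.

Let other_boxesT p : other_boxes p setT.
Proof. by exists (fun=> setT); split => //; apply/seteqP; split => w // _ q _. Qed.

Let other_boxesI p : setI_closed (other_boxes p).
Proof.
move=> _ _ [B [mB Bp ->]] [C [mC Cp ->]].
exists (fun q => B q `&` C q); split => [q||].
- exact: measurableI.
- by rewrite Bp Cp setTI.
- apply/seteqP; split => w.
    by move=> [Bw Cw] q _; split; [exact: Bw|exact: Cw].
  by move=> BCw; split=> q _; case: (BCw q Logic.I).
Qed.

(** As functions of [A] both sides are finite measures, a restriction and a multiple of [P]; they
    agree on boxes by the product rule, hence on the generated sigma-algebra. *)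
Let indep_other p (A : set T) (C : set R) : <<s other_boxes p >> A ->
  measurable C -> (P (A `&` X p @^-1` C) = P A * normal_prob 0 1 C)%E.
Proof.
have [_ [lawX indX]] := iidX.
move=> sA mC; have mXC := mXpre p mC.
have nc : normal_prob (0 : R) 1 C \is a fin_num.
  by rewrite fin_num_measure.
have c0 : 0 <= fine (normal_prob (0 : R) 1 C) by rewrite fine_ge0.
pose c := NngNum c0.
have cE A' : mscale c P A' = (normal_prob 0 1 C * P A')%E.
  by rewrite -[in RHS](fineK nc).
have -> : P (A `&` X p @^-1` C) = mrestr P mXC A by [].
have -> : (P A * normal_prob 0 1 C = mscale c P A)%E.
  by rewrite cE muleC.
apply: (g_sigma_algebra_measure_unique (other_boxes p) _ (fun=> setT)) => //.
- by rewrite bigcup_const.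
- move=> _ [B [mB Bp ->]]; rewrite [RHS]cE /= /mrestr.
  pose B' q := if q == p then C else B q.
  have mB' q : measurable (B' q) by rewrite /B'; case: ifP.
  have -> : (\bigcap_(q in [set: I]) X q @^-1` B q) `&` X p @^-1` C =
      \bigcap_(q in [set: I]) X q @^-1` B' q.
    apply/seteqP; split => w.
      by move=> [Bw Cw] q _; rewrite /B' /=; case: eqP => [->//|_]; exact: Bw.
    move=> Bw; split => [q _|].
      have := Bw q Logic.I; rewrite /B' /=; case: eqP => [->|//].
      by rewrite Bp.
    by have := Bw p Logic.I; rewrite /B' /= eqxx.
  rewrite !indX// (bigD1 p)//= (bigD1 (F := fun q => P (X q @^-1` B q)) p)//=.
  rewrite /B' eqxx Bp preimage_setT probability_setT mul1e lawX//.
  by congr (_ * _)%E; apply: eq_bigr => q /negPf ->.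
- by move=> k; rewrite /= /mrestr setTI (le_lt_trans (probability_le1 P _))// ltry.
Qed.

Lemma measurable_other p q : q != p ->
  measurable_fun setT (X q : g_sigma_algebraType (other_boxes p) -> R).
Proof.
move=> qp _ B mB; rewrite setTI; apply: sub_sigma_algebra.
exists (fun q' => if q' == q then B else setT); split => [q'||].
- by case: ifP.
- by rewrite eq_sym (negPf qp).
- apply/seteqP; split => w /=; first by move=> ? q' _ /=; case: eqP => // ->.
  by move=> /(_ q Logic.I); rewrite /= eqxx.
Qed.

(* Independence in the form of a disintegration: a function of the variables
   other than X p is a function measurable for the sigma-algebra generated by
   the boxes that do not constrain X p. *)
Lemma resample p (f : g_sigma_algebraType (other_boxes p) * measurableTypeR R -> \bar R) :
  measurable_fun setT f -> (forall z, 0 <= f z)%E ->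
  (\int[P]_w f (w, X p w) = \int[P]_w \int[normal_prob 0 1]_x f (w, x))%E.
Proof.
move=> mf f0.
pose T' : measurableType _ := g_sigma_algebraType (other_boxes p).
have mid : measurable_fun setT (id : T -> T').
  by move=> _ A mA; rewrite setTI; apply: (@sother p).
have mpair : measurable_fun setT (fun w : T => (w : T', X p w : measurableTypeR R)).
  by apply: measurable_fun_pair; [exact: mid|exact: mX].
(* The identity into the coarser sigma-algebra: its law is [P] restricted there, and by
   [indep_other] the law of [pairm] is the product of that law with the normal one. *)
pose idm : {mfun T >-> T'} := mfun_Sub (mem_set mid).
pose pairm : {mfun T >-> (T' * measurableTypeR R)%type} := mfun_Sub (mem_set mpair).
transitivity (\int[distribution P pairm]_z f z)%E.
  by rewrite ge0_integral_distribution.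
transitivity (\int[(distribution P idm \x normal_prob (0 : R) 1)%E]_z f z)%E.
  apply: eq_measure_integral => A mA _.
  apply/esym; apply: product_measure_unique => //.
  by move=> B C mB mC; exact: indep_other.
rewrite fubini_tonelli1// ge0_integral_distribution//.
  exact: measurable_fun_fubini_tonelli_F.
by move=> w; exact: integral_ge0.
Qed.

(* The variables are integrated out one at a time: integrating q turns the
   weight lam of its block into lam / (1 + 2 lam a_q^2), so that the factors
   telescope. *)
Lemma block_gauss_mgf (B : finType) (b : I -> B) (a : I -> R) (lam : B -> R)
    (J : seq I) :
  uniq J -> (forall i, 0 < 1 + 2 * lam i * \sum_(q <- J | b q == i) a q ^+ 2) ->
  (\int[P]_w (expR (- \sum_i
      lam i * (\sum_(q <- J | b q == i) a q * X q w) ^+ 2))%:E =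
   (\prod_i (Num.sqrt (1 + 2 * lam i * \sum_(q <- J | b q == i) a q ^+ 2))^-1)%:E)%E.
Proof.
elim: J lam => [lam _ _|p J IH lam /=/andP[pJ uJ] H].
  rewrite (eq_integral (fun=> 1%E)).
    rewrite (integral_cst P)// mul1e [X in X = _]probability_setT big1// => i _.
    by rewrite big_nil mulr0 addr0 sqrtr1 invr1.
  move=> w _; rewrite big1 ?oppr0 ?expR0// => i _.
  by rewrite big_nil expr0n mulr0.
set i0 := b p.
pose S i := \sum_(q <- J | b q == i) a q ^+ 2.
pose Z i w := \sum_(q <- J | b q == i) a q * X q w.
have S0 i : 0 <= S i by apply: sumr_ge0 => q _; exact: sqr_ge0.
pose v := 1 + 2 * lam i0 * a p ^+ 2.
have vS : 0 < v + 2 * lam i0 * S i0.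
  by have := H i0; rewrite big_cons eqxx -/(S i0) mulrDr addrA.
(* If [lam i0] is negative, the remaining terms of the block only lower the positive quantity in
   [vS], so [v] is positive as well. *)
have v0 : 0 < v.
  have [l0|l0] := leP 0 (lam i0).
    by rewrite ltr_wpDr// mulr_ge0 ?sqr_ge0// mulr_ge0.
  by apply: lt_le_trans vS _; rewrite gerDl mulr_le0_ge0// mulr_ge0_le0// ltW.
have sv0 : 0 < Num.sqrt v by rewrite sqrtr_gt0.
pose lam' i := if i == i0 then lam i0 / v else lam i.
pose K w := \sum_(i | i != i0) lam i * Z i w ^+ 2.
pose f (z : g_sigma_algebraType (other_boxes p) * measurableTypeR R) :=
  (expR (- K z.1) * expR (- (lam i0 * (Z i0 z.1 + a p * z.2) ^+ 2)))%:E.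
have mZ i : measurable_fun setT
    (Z i : g_sigma_algebraType (other_boxes p) -> R).
  apply: measurable_sum_seq => q qJ; apply: measurable_funM => //.
  by apply: measurable_other; apply: contraNneq pJ => <-.
have mK : measurable_fun setT (K : g_sigma_algebraType (other_boxes p) -> R).
  apply: measurable_sum_seq => i _; apply: measurable_funM => //.
  exact: measurable_funX.
have mf : measurable_fun setT f.
  apply/measurable_EFinP; apply: measurable_funM; apply: measurableT_comp => //.
    by apply: measurableT_comp => //; exact: measurableT_comp mK _.
  apply: measurableT_comp => //; apply: measurable_funM => //.
  apply: measurable_funX; apply: measurable_funD.
    exact: measurableT_comp (mZ i0) _.
  by apply: measurable_funM => //; exact: measurable_snd.
transitivity (\int[P]_w f (w, X p w))%E.
  apply: eq_integral => w _; rewrite /f -expRD; congr (expR _)%:E.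
  rewrite (bigD1 i0)//= big_cons eqxx -opprD addrC; congr (- (_ + _)).
    apply: eq_bigr => i ii0; congr (_ * _ ^+ 2).
    by rewrite big_cons eq_sym (negPf ii0).
  by rewrite addrC.
rewrite resample//; last by move=> z; rewrite lee_fin mulr_ge0// expR_ge0.
transitivity (\int[P]_w ((Num.sqrt v)^-1%:E *
    (expR (- \sum_i lam' i * Z i w ^+ 2))%:E))%E.
  apply: eq_integral => w _; rewrite /f.
  transitivity ((expR (- K w))%:E * \int[normal_prob 0 1]_x
      (expR (- (lam i0 * (Z i0 w + a p * x) ^+ 2)))%:E)%E.
    rewrite -(@ge0_integralZl_EFin _ _ _ _ _ _ _ _ _ (expR (- K w)))//.
    apply/measurable_EFinP; apply: measurableT_comp => //.
    apply: measurableT_comp => //; apply: measurable_funM => //.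
    by apply: measurable_funX; apply: measurable_funD.
  rewrite gauss_expR_sqr// -!EFinM; congr EFin; rewrite mulrCA -expRD.
  congr (_ * expR _); rewrite -opprD [in RHS](bigD1 i0)//= {1}/lam' eqxx addrC.
  by congr (- (_ + _)); apply: eq_bigr => i ii0; rewrite /lam' (negPf ii0).
rewrite ge0_integralZl_EFin ?invr_ge0 ?sqrtr_ge0//; last first.
  apply/measurable_EFinP; apply: measurableT_comp => //.
  apply: measurableT_comp => //; apply: measurable_sum_seq => i _.
  apply: measurable_funM => //; apply: measurable_funX.
  by apply: measurable_sum_seq => q _; apply: measurable_funM.
have lam'E : 1 + 2 * lam' i0 * S i0 = (v + 2 * lam i0 * S i0) / v.
  by rewrite /lam' eqxx; field; rewrite gt_eqF.
rewrite IH//; last first.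
  move=> i; have [->|ii0] := eqVneq i i0; first by rewrite lam'E divr_gt0.
  by have := H i; rewrite big_cons eq_sym (negPf ii0) /lam' (negPf ii0).
rewrite -EFinM; congr EFin; rewrite (bigD1 i0)//= [in RHS](bigD1 i0)//= mulrA.
congr (_ * _); last first.
  apply: eq_bigr => i ii0.
  by rewrite big_cons eq_sym (negPf ii0) /lam' (negPf ii0).
rewrite -/(S i0) lam'E big_cons eqxx -/(S i0) [in RHS]mulrDr [in RHS]addrA -/v.
rewrite sqrtrM ?(ltW vS)// sqrtrV ?(ltW v0)// invfM invrK mulrCA mulVf ?mulr1//.
by rewrite gt_eqF.
Qed.

End resampling.

(** * Exponential moments for a Gaussian matrix *)

Section gaussian_matrix.
Context (R : realType) (d : measure_display) (T : measurableType d).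
Context (P : probability T R) (m k : nat) (X : 'I_m * 'I_k -> T -> R).
Hypothesis iidX : iid_std_gaussian P X.

Let E w : 'M[R]_(m, k) := \matrix_(i < m, j < k) X (i, j) w.

Let mX q : measurable_fun setT (X q). Proof. by have [] := iidX. Qed.

Lemma measurable_enorm_sqr_mulmx (l : nat) (V : 'M[R]_(l, m)) (y : 'cV[R]_k) :
  measurable_fun setT (fun w => enorm (V *m E w *m y) ^+ 2).
Proof.
under eq_fun do rewrite enorm_sqr.
apply: measurable_sum_seq => i _; apply: measurable_funX.
under eq_fun do rewrite mxE.
apply: measurable_sum_seq => j _; apply: measurable_funM => //.
under eq_fun do rewrite mxE.
apply: measurable_sum_seq => n _; apply: measurable_funM => //.
by under eq_fun do rewrite mxE; exact: mX.
Qed.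

(** One block map and one weight vector make the supports of the rows disjoint by construction; the
    rows are orthonormal once each block of [v] has norm 1. *)
Definition disjoint_rows_mx (l : nat) (b : 'I_m -> 'I_l) (v : 'I_m -> R) :
  'M[R]_(l, m) := \matrix_(i, n) if b n == i then v n else 0.

(** Entry i of V E y combines the variables of block i with coefficients v_n y_c, whose squares sum
    to |y|^2, so the l blocks give equal factors. Positive [lam] serves the small-ball bound,
    negative [lam] the operator norm. *)
Lemma mgf_enorm_sqr (l : nat) (b : 'I_m -> 'I_l) (v : 'I_m -> R)
    (y : 'cV[R]_k) (lam : R) :
  (forall i, \sum_(n | b n == i) v n ^+ 2 = 1) ->
  0 < 1 + 2 * lam * enorm y ^+ 2 ->
  (\int[P]_w (expR (- (lam *
      enorm (disjoint_rows_mx b v *m E w *m y) ^+ 2)))%:E =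
   ((Num.sqrt (1 + 2 * lam * enorm y ^+ 2))^-1 ^+ l)%:E)%E.
Proof.
move=> v1 H.
have S1 i : \sum_(q : 'I_m * 'I_k | b q.1 == i) (v q.1 * y q.2 0) ^+ 2 =
    enorm y ^+ 2.
  under eq_bigl do rewrite -[_ == _]andbT.
  rewrite -(pair_big_dep (fun n => b n == i) (fun _ _ => true)
    (fun n c => (v n * y c 0) ^+ 2))/=.
  under eq_bigr do under eq_bigr do rewrite exprMn.
  by under eq_bigr do rewrite -mulr_sumr -enorm_sqr; rewrite -mulr_suml v1 mul1r.
have := @block_gauss_mgf _ _ _ _ _ _ iidX _ (fun q => b q.1)
  (fun q => v q.1 * y q.2 0) (fun=> lam) (index_enum _) (index_enum_uniq _).
move=> mgf.
transitivity ((\prod_(i < l) (Num.sqrt (1 + 2 * lam *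
    \sum_(q : 'I_m * 'I_k | b q.1 == i) (v q.1 * y q.2 0) ^+ 2))^-1)%:E); last first.
  by congr EFin; under eq_bigr do rewrite S1; rewrite prodr_const card_ord.
rewrite -mgf; last by move=> i; rewrite S1.
apply: eq_integral => w _; rewrite enorm_sqr mulr_sumr.
congr (expR (- _))%:E; apply: eq_bigr => i _; congr (_ * _ ^+ 2).
rewrite -mulmxA mxE (bigID (fun n => b n == i))/= [X in _ + X]big1 ?addr0; last first.
  by move=> n /negPf bn; rewrite mxE bn mul0r.
have -> : \sum_(q : 'I_m * 'I_k | b q.1 == i) v q.1 * y q.2 0 * X q w =
    \sum_(n | b n == i) \sum_c v n * y c 0 * X (n, c) w.
  by rewrite pair_big_dep/=; apply: eq_big => -[n c]; rewrite ?andbT.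
apply: eq_bigr => n bn; rewrite mxE bn mxE mulr_sumr; apply: eq_bigr => c _.
by rewrite mxE mulrA mulrAC.
Qed.

(** Each entry is its own block here, and [la] vanishes off row [n], which leaves k nontrivial
    factors. *)
Lemma mgf_row_sqr (n : 'I_m) (lam : R) : 0 < 1 + 2 * lam ->
  (\int[P]_w (expR (- (lam * \sum_c X (n, c) w ^+ 2)))%:E =
   ((Num.sqrt (1 + 2 * lam))^-1 ^+ k)%:E)%E.
Proof.
move=> H.
pose la (q : 'I_m * 'I_k) := if q.1 == n then lam else 0.
have S1 (q : 'I_m * 'I_k) : \sum_(q' | id q' == q) (1 : R) ^+ 2 = 1.
  by rewrite big_pred1_eq expr1n.
have := @block_gauss_mgf _ _ _ _ _ _ iidX _ id (fun=> 1) la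
  (index_enum _) (index_enum_uniq _).
move=> mgf.
transitivity ((\prod_q (Num.sqrt (1 + 2 * la q *
    \sum_(q' | id q' == q) (1 : R) ^+ 2))^-1)%:E); last first.
  congr EFin; under eq_bigr do rewrite S1 mulr1; transitivity (\prod_(a < m) \prod_(c < k)
    (Num.sqrt (1 + 2 * la (a, c)))^-1).
    by rewrite pair_bigA; apply: eq_bigr => -[].
  rewrite (bigD1 n)//= /la/= eqxx prodr_const card_ord big1 ?mulr1// => a an.
  by rewrite big1// => c _; rewrite (negPf an) mulr0 addr0 sqrtr1 invr1.
rewrite -mgf; last first.
  by move=> q; rewrite S1 mulr1 /la; case: ifP => _ //; rewrite mulr0 addr0.
apply: eq_integral => w _; congr (expR (- _))%:E.
transitivity (\sum_(a < m) \sum_(c < k) la (a, c) * (1 * X (a, c) w) ^+ 2).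
  rewrite (bigD1 n)//= [X in _ + X]big1 ?addr0.
    rewrite mulr_sumr; apply: eq_bigr => c _; by rewrite /la/= eqxx mul1r.
  move=> a an; rewrite big1// => c _; by rewrite /la/= (negPf an) mul0r.
rewrite pair_bigA; apply: eq_bigr => -[a c] _ /=; congr (_ * _ ^+ 2).
by rewrite big_pred1_eq.
Qed.

End gaussian_matrix.

(** * Beta quantization *)

Section left_inverse.
Context (R : realType).

Lemma enorm_trmx (l : nat) (x : 'cV[R]_l) : x^T *m x = (enorm x ^+ 2)%:M.
Proof.
apply/matrixP => i j; rewrite !ord1 enorm_sqr !mxE eqxx mulr1n.
by apply: eq_bigr => n _; rewrite mxE expr2.
Qed.

(** A kernel vector x of M^T M satisfies |M x|^2 = x^T M^T M x = 0, hence x = 0. *)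
Lemma gram_unitmx (l k : nat) (M : 'M[R]_(l, k)) (tau : R) : 0 < tau ->
  (forall x, tau * enorm x <= enorm (M *m x)) -> M^T *m M \in unitmx.
Proof.
move=> t0 H; rewrite -unitmx_tr -row_free_unit -kermx_eq0; apply/eqP/row_matrixP => i.
rewrite row0; apply: trmx_inj; apply/eqP; rewrite trmx0 -enorm_eq0.
set x := (row i _)^T.
have GX : M^T *m M *m x = 0.
  apply: trmx_inj; rewrite trmx_mul trmxK trmx0 -row_mul.
  by rewrite mulmx_ker row0.
have Mx0 : enorm (M *m x) = 0.
  apply/eqP; rewrite -sqrf_eq0.
  have := enorm_trmx (M *m x); rewrite trmx_mul -mulmxA (mulmxA _ M) GX mulmx0.
  by move=> /matrixP/(_ 0 0)/esym; rewrite !mxE eqxx mulr1n => ->.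
have := H x; rewrite Mx0 pmulr_rle0// => x0.
by rewrite eq_le x0 enorm_ge0.
Qed.

(* z = (M^T M)^-1 M^T r is the least-squares solution: |M z|^2 = (M z, r). *)
Lemma least_squares_bound (l k : nat) (M : 'M[R]_(l, k)) (tau : R) (r : 'cV[R]_l) :
  0 < tau -> (forall x, tau * enorm x <= enorm (M *m x)) ->
  tau * enorm (invmx (M^T *m M) *m M^T *m r) <= enorm r.
Proof.
move=> t0 H; have U := gram_unitmx t0 H.
set z := _ *m r; apply: le_trans (H z) _.
have Gz : M^T *m (M *m z) = M^T *m r.
  by rewrite mulmxA /z !mulmxA mulmxV// mul1mx.
have zr : enorm (M *m z) ^+ 2 = \sum_i (M *m z) i 0 * r i 0.
  have := enorm_trmx (M *m z); rewrite {1}trmx_mul -mulmxA Gz mulmxA -trmx_mul.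
  move=> /matrixP/(_ 0 0); rewrite !mxE eqxx mulr1n => <-.
  by apply: eq_bigr => i _; rewrite mxE.
have := cauchy_schwarz (M *m z) r; rewrite -zr expr2.
have [->|Mz] := eqVneq (enorm (M *m z)) 0; first by rewrite enorm_ge0.
by rewrite ler_pM2l// lt_def Mz enorm_ge0.
Qed.

End left_inverse.

(** * The alphabet *)

Section alphabet.
Context (R : realType).

(** L points with spacing 2 delta, symmetric about 0: the intervals of radius delta around them tile
    [-L delta, L delta]. *)
Definition midrise_alphabet (L : nat) (delta : R) : seq R :=
  [seq (2 * j%:R + 1 - L%:R) * delta | j <- iota 0 L].

Lemma size_midrise_alphabet L delta : size (midrise_alphabet L delta) = L.
Proof. by rewrite size_map size_iota. Qed.

Lemma uniq_midrise_alphabet L delta : delta != 0 -> uniq (midrise_alphabet L delta).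
Proof.
move=> d0; rewrite map_inj_uniq ?iota_uniq// => i j /(mulIf d0).
by move=> H; apply/eqP; rewrite -(eqr_nat R); apply/eqP; lra.
Qed.

Lemma midrise_round (L : nat) (delta s : R) : (0 < L)%N -> 0 < delta ->
  `|s| <= L%:R * delta ->
  exists2 q, q \in midrise_alphabet L delta & `|s - q| <= delta.
Proof.
move=> L0 d0 sL.
pose u := (s / delta + L%:R) / 2.
have sE : s = (2 * u - L%:R) * delta by rewrite /u; field; rewrite gt_eqF.
have [u0 uL] : 0 <= u /\ u <= L%:R.
  have : `|s / delta| <= L%:R.
    by rewrite normrM normfV (gtr0_norm d0) ler_pdivrMr.
  by rewrite ler_norml /u => /andP[? ?]; split; lra.
have /andP[t1 t2] := truncn_itv u0.
(* The minimum only matters at the right endpoint s = L delta, where truncation gives L. *)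
pose j := minn (Num.truncn u) L.-1.
have jL : (j < L)%N by rewrite /j -(prednK L0) ltnS geq_minr.
have [j1 j2] : j%:R <= u /\ u <= j%:R + 1 :> R.
  rewrite /j; split.
    by apply: le_trans t1; rewrite ler_nat geq_minl.
  have [tL|tL] := leqP (Num.truncn u) L.-1.
    by rewrite natr1 ltW.
  by rewrite natr1 prednK.
exists ((2 * j%:R + 1 - L%:R) * delta).
  by apply/mapP; exists j => //; rewrite mem_iota.
rewrite {1}sE -mulrBl normrM (gtr0_norm d0) -[leRHS]mul1r ler_pM2r//.
by rewrite ler_norml; apply/andP; split; lra.
Qed.

End alphabet.

(** * Greedy expansions and the resulting dual frame *)

Section beta_quantization.
Context (R : realType).

(** The weighted sum is the state of the recursion u_(n+1) = beta u_n + y_n - q_n. If |u_n| <=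
    delta, then |beta u_n + y_n| <= beta delta + (L - beta) delta = L delta, which is the range
    where rounding has error at most delta. *)
Lemma greedy_beta_expansion (L : nat) (beta delta : R) (y : nat -> R) :
  (0 < L)%N -> 0 <= beta -> 0 < delta ->
  (forall j, `|y j| <= (L%:R - beta) * delta) ->
  exists q : nat -> R, (forall j, q j \in midrise_alphabet L delta) /\
    (forall n, `|\sum_(j < n) beta ^+ (n.-1 - j) * (y j - q j)| <= delta).
Proof.
move=> L0 b0 d0 yb.
(* Outside the range any letter will do; the one nearest to 0 is taken so that [rd] is total. *)
have /choice[rd rdP] : forall s : R, exists q, q \in midrise_alphabet L delta /\
    (`|s| <= L%:R * delta -> `|s - q| <= delta).
  move=> s; have [sL|sL] := leP `|s| (L%:R * delta).
    by have [q qA sq] := midrise_round L0 d0 sL; exists q.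
  have [|q qA _] := @midrise_round _ L delta 0 L0 d0.
    by rewrite normr0 mulr_ge0// ltW.
  by exists q.
pose u := fix u n := if n is n'.+1 then
  beta * u n' + y n' - rd (beta * u n' + y n') else 0.
exists (fun j => rd (beta * u j + y j)); split => [j|n].
  by case: (rdP (beta * u j + y j)).
have uE : \sum_(j < n) beta ^+ (n.-1 - j) * (y j - rd (beta * u j + y j)) = u n.
  elim: n => [|n IH]; first by rewrite big_ord0.
  rewrite big_ord_recr/= subnn expr0 mul1r -IH mulr_sumr -addrA; congr (_ + _).
  apply: eq_bigr => j _; rewrite mulrA -exprS; congr (_ ^+ _ * _).
  have := ltn_ord j; lia.
rewrite uE; elim: n {uE} => [|n IH] /=; first by rewrite normr0 ltW.
have [_] := rdP (beta * u n + y n); apply.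
rewrite (le_trans (ler_normD _ _))// normrM (ger0_norm b0).
have := ler_wpM2l b0 IH; have := yb n; nra.
Qed.

Variables (m l' p : nat).
Hypotheses (p0 : (0 < p)%N) (lpm : (l'.+1 * p <= m)%N).
Let l := l'.+1.

Definition beta_block (n : 'I_m) : 'I_l := inord (n %/ p).

(* Rows beyond l p get weight 0; the block assigned to them is irrelevant. *)
Definition beta_weight (beta : R) (n : 'I_m) : R :=
  if (n < l * p)%N then
    beta ^- (n %% p) / Num.sqrt (\sum_(j < p) (beta ^- j) ^+ 2) else 0.

(** The guard removes the tail rows, whose block is a default value of [inord]; what remains of
    block i is the interval from i p to i p + p - 1. *)
Lemma sum_beta_block (i : 'I_l) (G : nat -> R) :
  \sum_(n < m | beta_block n == i) (if (n < l * p)%N then G n else 0) =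
  \sum_(j < p) G (i * p + j)%N.
Proof.
have ip : (i * p + p <= m)%N.
  by apply: leq_trans lpm; rewrite -mulSnr leq_mul2r ltn_ord orbT.
transitivity (\sum_(n < m | (i * p <= n < i * p + p)%N) G n).
  rewrite big_mkcond [RHS]big_mkcond; apply: eq_bigr => n _.
  rewrite /beta_block -val_eqE/=.
  have [nlp|nlp] := ltnP n (l * p).
    rewrite inordK ?ltn_divLR// -mulSnr.
    by rewrite -leq_divRL// -ltn_divLR// ltnS -eqn_leq eq_sym.
  rewrite if_same ifF//; apply/negbTE; rewrite negb_and.
  apply/orP; right; rewrite -leqNgt; apply: leq_trans nlp.
  by rewrite -mulSnr leq_mul2r ltn_ord orbT.
rewrite -(big_mkord (fun n => i * p <= n < i * p + p)%N).
rewrite (@big_cat_nat _ _ _ (i * p))//=; last by apply: leq_trans ip; exact: leq_addr.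
rewrite big_nat_cond big_pred0 ?add0r; last by move=> n; lia.
rewrite (@big_cat_nat _ _ _ (i * p + p))//= ?leq_addr//.
rewrite [X in _ + X]big_nat_cond [X in _ + X]big_pred0 ?addr0; last by move=> n; lia.
rewrite -{1}[(i * p)%N]add0n big_addn addKn big_mkord big_mkcond/=.
apply: eq_bigr => j _; rewrite [(j + _)%N]addnC ifT//.
by have := ltn_ord j; lia.
Qed.

(** The term j = 0 equals 1. Consequently normalizing the weights cannot increase the quantization
    error. *)
Lemma beta_weight_norm_ge1 (beta : R) :
  1 <= Num.sqrt (\sum_(j < p) (beta ^- j) ^+ 2).
Proof.
rewrite -[leLHS]sqrtr1 ler_wsqrtr// -(prednK p0) big_ord_recl expr0 invr1 expr1n.
by rewrite lerDl sumr_ge0// => j _; exact: sqr_ge0.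
Qed.

Lemma beta_weight_unit (beta : R) (i : 'I_l) :
  \sum_(n | beta_block n == i) beta_weight beta n ^+ 2 = 1.
Proof.
set s := Num.sqrt (\sum_(j < p) (beta ^- j) ^+ 2).
have s1 : 1 <= s := beta_weight_norm_ge1 beta.
transitivity (\sum_(n < m | beta_block n == i)
    (if (n < l * p)%N then (beta ^- (n %% p) / s) ^+ 2 else 0)).
  by apply: eq_bigr => n _; rewrite /beta_weight; case: ifP => // _; rewrite expr0n.
rewrite (sum_beta_block i (fun n => (beta ^- (n %% p) / s) ^+ 2)).
under eq_bigr do rewrite modnMDl modn_small ?ltn_ord// exprMn.
rewrite -mulr_suml -[X in X * _]sqr_sqrtr ?sumr_ge0// => [|j _]; last exact: sqr_ge0.
by rewrite -/s -exprMn divff ?expr1n// gt_eqF// (lt_le_trans ltr01).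
Qed.

Lemma beta_quantize (L : nat) (beta delta : R) (y : 'cV[R]_m) :
  (0 < L)%N -> 0 < beta -> 0 < delta ->
  (forall n, `|y n 0| <= (L%:R - beta) * delta) ->
  exists2 q : 'cV[R]_m, alph_vecs (midrise_alphabet L delta) q &
    enorm (disjoint_rows_mx beta_block (beta_weight beta) *m (y - q)) <=
    Num.sqrt l%:R * (beta ^- p.-1 * delta).
Proof.
move=> L0 b0 d0 yb.
pose yn n : R := if insub n is Some o then y o 0 else 0.
have ynE (n : 'I_m) : yn n = y n 0 by rewrite /yn valK.
have ynb n : `|yn n| <= (L%:R - beta) * delta.
  rewrite /yn; case: insubP => [a _ _|nm]; first exact: yb.
  have mp : (0 < m)%N by apply: leq_trans lpm; rewrite muln_gt0.
  by rewrite normr0 (le_trans _ (yb (Ordinal mp))).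
have /choice[Q QP] : forall i : 'I_l, exists q : nat -> R,
    (forall j, q j \in midrise_alphabet L delta) /\ (forall n,
    `|\sum_(j < n) beta ^+ (n.-1 - j) * (yn (i * p + j)%N - q j)| <= delta).
  move=> i.
  by apply: (greedy_beta_expansion (y := fun j => yn (i * p + j)%N)); rewrite ?ltW.
exists (\col_n Q (beta_block n) (n %% p)%N).
  by move=> n; rewrite mxE; case: (QP (beta_block n)).
set s := Num.sqrt (\sum_(j < p) (beta ^- j) ^+ 2).
have s1 : 1 <= s := beta_weight_norm_ge1 beta.
have s0 : 0 < s := lt_le_trans ltr01 s1.
have bd0 : 0 <= beta ^- p.-1 * delta by rewrite mulr_ge0 ?invr_ge0 ?exprn_ge0 ?ltW.
set V := disjoint_rows_mx _ _; set q := (X in y - X).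
(* Pulling beta^(1-p) out of the weights beta^-j leaves the state of the greedy expansion after p
   steps. *)
have Vi i : (V *m (y - q)) i 0 = beta ^- p.-1 / s *
    \sum_(j < p) beta ^+ (p.-1 - j) * (yn (i * p + j)%N - Q i j).
  rewrite mxE (bigID (fun n => beta_block n == i))/= [X in _ + X]big1 ?addr0; last first.
    by move=> n /negPf bn; rewrite mxE bn mul0r.
  pose G n := beta ^- (n %% p) / s * (yn n - Q i (n %% p)%N).
  transitivity (\sum_(n < m | beta_block n == i) (if (n < l * p)%N then G n else 0)).
    apply: eq_bigr => n bn; rewrite !mxE bn (eqP bn) /beta_weight /G ynE.
    by case: ifP => // _; rewrite mul0r.
  rewrite sum_beta_block mulr_sumr; apply: eq_bigr => j _.
  rewrite /G modnMDl modn_small ?ltn_ord// mulrA; congr (_ * _).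
  rewrite mulrAC; congr (_ / _).
  have jp : (j <= p.-1)%N by rewrite -ltnS prednK.
  by rewrite -{1}(subnK jp) exprD invfM mulrAC mulVf ?mul1r// expf_neq0// gt_eqF.
rewrite -(ler_pXn2r (ltn0Sn 1)) ?nnegrE ?enorm_ge0//; last by rewrite mulr_ge0 ?sqrtr_ge0.
rewrite enorm_sqr exprMn sqr_sqrtr//.
apply: (@le_trans _ _ (\sum_(i < l) (beta ^- p.-1 * delta) ^+ 2)); last first.
  by rewrite sumr_const card_ord mulr_natl.
apply: ler_sum => i _; rewrite Vi -[leLHS](real_normK (num_real _)).
rewrite ler_pXn2r ?nnegrE// normrM.
have bp0 : 0 <= beta ^- p.-1 by rewrite invr_ge0 exprn_ge0// ltW.
have bs0 : 0 <= beta ^- p.-1 / s by rewrite divr_ge0// ltW.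
rewrite (ger0_norm bs0); apply: ler_pM => //.
  by rewrite ler_piMr// invf_le1.
by have [_] := QP i; exact.
Qed.

Lemma Da_le (k L : nat) (E : 'M[R]_(m, k)) (beta mu tau : R) :
  (0 < L)%N -> 0 < beta -> beta < L%:R -> 0 < mu -> 0 < tau ->
  (forall x, enorm x <= 1 -> forall n, `|(E *m x) n 0| <= mu) ->
  (forall x, tau * enorm x <=
     enorm (disjoint_rows_mx beta_block (beta_weight beta) *m E *m x)) ->
  (Da E L <= (Num.sqrt l%:R * (beta ^- p.-1 * (mu / (L%:R - beta))) / tau)%:E)%E.
Proof.
move=> L0 b0 bL mu0 t0 Emu H.
(* With this [delta], the bound [mu] on the coordinates of E x is exactly the stability bound (L -
   beta) delta of the greedy expansion. *)
set V := disjoint_rows_mx _ _ in H; set delta := mu / _.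
have d0 : 0 < delta by rewrite divr_gt0// subr_gt0.
pose A := midrise_alphabet L delta.
pose G := (V *m E)^T *m (V *m E).
pose F := invmx G *m (V *m E)^T *m V.
have FE : F *m E = 1%:M.
  by rewrite /F -(mulmxA _ V E) -mulmxA mulVmx//; exact: gram_unitmx t0 H.
apply: (@le_trans _ _ (Ds F A (@unit_ball R k))).
  apply: (@le_trans _ _ (Da_A E A (@unit_ball R k))); apply: ereal_inf_lbound.
    exists A => //; split; last exact: size_midrise_alphabet.
    by apply: uniq_midrise_alphabet; rewrite gt_eqF.
  by exists F.
apply: ub_ereal_sup => _ [x x1 <-].
have [|q qA Vq] := @beta_quantize L beta delta (E *m x) L0 b0 d0.
  move=> n; rewrite /delta mulrC divfK ?gt_eqF ?subr_gt0//; exact: Emu.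
apply: le_trans (ereal_inf_lbound _) _; first by exists q.
rewrite lee_fin ler_pdivlMr// mulrC; apply: le_trans Vq.
have -> : x - F *m q = invmx G *m (V *m E)^T *m (V *m (E *m x - q)).
  by rewrite mulmxA -/F mulmxBr mulmxA FE mul1mx.
exact: least_squares_bound.
Qed.

End beta_quantization.

(** * The least singular value *)

Section nets.
Context (R : realType).

Lemma cauchy_schwarz_sqr (k : nat) (x y : 'cV[R]_k) :
  (\sum_i x i 0 * y i 0) ^+ 2 <= enorm x ^+ 2 * enorm y ^+ 2.
Proof.
rewrite -exprMn -[leLHS](real_normK (num_real _)).
rewrite ler_pXn2r ?nnegrE ?mulr_ge0 ?enorm_ge0// ler_norml cauchy_schwarz andbT.
rewrite lerNl -enormN; apply: le_trans (cauchy_schwarz _ _).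
by rewrite -sumrN; apply: ler_sum => i _; rewrite mxE mulNr.
Qed.

(** The constant is the Frobenius norm; it guarantees that the supremum in [opnorm_net] is
    finite. *)
Lemma enorm_mulmx_bounded (l k : nat) (M : 'M[R]_(l, k)) :
  exists2 c, 0 <= c & forall x, enorm (M *m x) <= c * enorm x.
Proof.
exists (Num.sqrt (\sum_i enorm (row i M)^T ^+ 2)); first exact: sqrtr_ge0.
move=> x; rewrite -(ler_pXn2r (ltn0Sn 1)) ?nnegrE ?mulr_ge0 ?enorm_ge0 ?sqrtr_ge0//.
rewrite exprMn [X in _ <= X * _]sqr_sqrtr ?sumr_ge0// => [|i _]; last exact: sqr_ge0.
rewrite enorm_sqr mulr_suml; apply: ler_sum => i _.
apply: le_trans (cauchy_schwarz_sqr _ _); rewrite mxE le_eqVlt; apply/orP; left.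
by apply/eqP; congr (_ ^+ 2); apply: eq_bigr => j _; rewrite !mxE.
Qed.

Lemma enorm_mulmxZ_bound (l k : nat) (M : 'M[R]_(l, k)) (c : R) :
  (forall x, enorm x <= 1 -> enorm (M *m x) <= c) ->
  forall x, enorm (M *m x) <= c * enorm x.
Proof.
move=> H x; have [->|x0] := eqVneq x 0; first by rewrite mulmx0 !enorm0 mulr0.
have nx : 0 < enorm x by rewrite lt_def enorm_eq0 x0 enorm_ge0.
have := H ((enorm x)^-1 *: x).
rewrite -scalemxAr !enormZ gtr0_norm ?invr_gt0// mulVf ?gt_eqF// lexx => /(_ isT).
by rewrite ler_pdivrMl// mulrC.
Qed.

(** Approximating x by a net point shows that the norm s of M satisfies s <= c + eps s; as s is
    finite, this can be solved for s. *)
Lemma opnorm_net (l k : nat) (M : 'M[R]_(l, k)) (N : seq 'cV[R]_k) (eps c : R) :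
  0 <= eps -> eps < 1 ->
  (forall x, enorm x <= 1 -> exists2 y, y \in N & enorm (x - y) <= eps) ->
  (forall y, y \in N -> enorm (M *m y) <= c) ->
  forall x, enorm (M *m x) <= c / (1 - eps) * enorm x.
Proof.
move=> e0 e1 cov Nc; apply: enorm_mulmxZ_bound.
pose A := [set enorm (M *m x) | x in [set x : 'cV[R]_k | enorm x <= 1]].
have Aub : has_ubound A.
  have [b b0 bP] := enorm_mulmx_bounded M; exists b => _ [x x1 <-].
  by apply: le_trans (bP x) _; rewrite ler_piMr.
have A0 : A !=set0 by exists (enorm (M *m 0)), 0 => //=; rewrite enorm0.
have supM x : enorm x <= 1 -> enorm (M *m x) <= sup A.
  by move=> x1; apply: ub_le_sup => //; exists x.
have : sup A <= c + eps * sup A.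
  apply: ge_sup => // _ [x x1 <-].
  have [y yN xy] := cov x x1.
  rewrite -[x](subrK y) addrC mulmxDr (le_trans (enormD _ _))// lerD ?Nc//.
  apply: le_trans (enorm_mulmxZ_bound supM _) _; rewrite mulrC ler_wpM2r//.
  by apply: le_trans (supM 0 _); rewrite ?enorm_ge0// enorm0.
move=> sA x /supM xs; apply: le_trans xs _; rewrite ler_pdivlMr ?subr_gt0//.
by move: sA; lra.
Qed.

(** A unit vector is within eps of a net point y, necessarily of norm at least 1 - eps, and passing
    from y to it loses at most c eps. Short net points must be excluded, as |M y| is small for
    them. *)
Lemma min_singular_value_net (l k : nat) (M : 'M[R]_(l, k)) (N : seq 'cV[R]_k)
    (eps c r : R) :
  (forall x, enorm x <= 1 -> exists2 y, y \in N & enorm (x - y) <= eps) ->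
  0 <= c -> (forall x, enorm (M *m x) <= c * enorm x) ->
  (forall y, y \in N -> 1 - eps <= enorm y -> r <= enorm (M *m y)) ->
  forall x, (r - c * eps) * enorm x <= enorm (M *m x).
Proof.
move=> cov c0 Mc Nr x; have [->|x0] := eqVneq x 0.
  by rewrite mulmx0 !enorm0 mulr0.
have nx : 0 < enorm x by rewrite lt_def enorm_eq0 x0 enorm_ge0.
pose z := (enorm x)^-1 *: x.
have z1 : enorm z = 1 by rewrite enormZ gtr0_norm ?invr_gt0// mulVf// gt_eqF.
have -> : enorm (M *m x) = enorm x * enorm (M *m z).
  by rewrite -scalemxAr enormZ gtr0_norm ?invr_gt0// mulrA divff ?mul1r// gt_eqF.
rewrite mulrC ler_wpM2l ?enorm_ge0//.
have [|y yN zy] := cov z; first by rewrite z1.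
have y1 : 1 - eps <= enorm y.
  by have := ler_enormB z (z - y); rewrite subKr z1; lra.
have := Nr y yN y1; have := ler_enormB (M *m y) (M *m (y - z)).
rewrite -mulmxBr subKr => H1 H2.
have H3 : enorm (M *m (y - z)) <= c * eps.
  by apply: le_trans (Mc _) _; rewrite ler_wpM2l// -enormN opprB.
by move: H1 H2 H3; lra.
Qed.

End nets.

(** * Numerical bounds on the exponential *)

Section numerics.
Context (R : realType).

(** The partial sum up to 1/(n+2)!, increased by 1/(2 (n+2)!), is nonincreasing in n and starts at
    5/2 + 1/4. *)
Lemma expR1_le : expR 1 <= 11 / 4 :> R.
Proof.
rewrite /expR; apply: limr_le; first exact: is_cvg_series_exp_coeff.
have H n : series (exp_coeff (1 : R)) n.+3 + (2 * n.+2`!%:R)^-1 <= 11 / 4.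
  elim: n => [|n IH].
    rewrite /series/= !big_nat_recr//= big_nil /exp_coeff/= !expr1n !factS fact0.
    by rewrite !natrM; lra.
  apply: le_trans IH; rewrite [in leLHS]/series/= big_nat_recr//= -addrA lerD2l.
  rewrite /exp_coeff/= expr1n mul1r [n.+3`!]factS natrM.
  have f0 : 0 < n.+2`!%:R :> R by rewrite ltr0n fact_gt0.
  have n0 : 3 <= n.+3%:R :> R by rewrite ler_nat.
  rewrite -subr_ge0.
  have -> : (2 * n.+2`!%:R)^-1 - ((n.+3%:R * n.+2`!%:R)^-1 +
      (2 * (n.+3%:R * n.+2`!%:R))^-1) =
      (n.+3%:R - 3) / (2 * n.+3%:R * n.+2`!%:R) :> R.
    by field; rewrite !gt_eqF// (lt_le_trans _ n0).
  by rewrite divr_ge0 ?subr_ge0// !mulr_ge0// ltW.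
near=> n; have n3 : (3 <= n)%N by near: n; exists 3%N.
have := H (n - 3)%N; rewrite -[(n - 3).+3]addn3 subnK//.
by apply: le_trans; rewrite lerDl invr_ge0 mulr_ge0.
Unshelve. all: by end_near.
Qed.

Lemma expR_quarter_ge : 41 / 32 <= expR 4^-1 :> R.
Proof.
have h : 0 <= 4^-1 :> R by lra.
by apply: le_trans (expR_ge_quadratic h); lra.
Qed.

Lemma expR_half_ge : 100 / 61 <= expR 2^-1 :> R.
Proof.
have -> : 2^-1 = 4^-1 *+ 2 :> R by field.
rewrite mulr2n expRD; have := expR_quarter_ge; nra.
Qed.

Lemma expR2_ge : 6 <= expR 2 :> R.
Proof.
have -> : 2 = 2^-1 + 2^-1 + (2^-1 + 2^-1) :> R by field.
rewrite !expRD; have := expR_half_ge; set e := expR _ => ?.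
have : 5/2 <= e * e by nra.
nra.
Qed.

Lemma expR3_ge : 75 / 4 <= expR 3 :> R.
Proof.
have -> : 3 = 2^-1 + 2^-1 + (2^-1 + 2^-1) + (2^-1 + 2^-1) :> R by field.
rewrite !expRD; have := expR_half_ge; set e := expR _ => ?.
have : 268/100 <= e * e by nra.
set f := e * e => ?; have : 718/100 <= f * f by nra.
nra.
Qed.

End numerics.

(* For t >= 1/2, the numerical choices below are: nets of mesh 1/25 for the
   operator norm and 33/50 e^-t / net_opnorm t for the least singular value;
   exponential moments of parameter 4/9, for which (1 - 2 * 4/9)^(-1/2) = 3. *)
Definition net_opnorm (R : realType) (t : R) : R := 13 / 8 * Num.sqrt (t + 5 / 2).

Definition net_mesh (R : realType) (t : R) : R :=
  33 / 50 * expR (- t) / net_opnorm t.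

(** * Numerics of the union bounds *)

Section union_bound_numerics.
Context (R : realType).
Implicit Types t : R.

Lemma expRN_le t : 2^-1 <= t -> expR (- t) <= 61 / 100.
Proof.
move=> t_ge; apply: (@le_trans _ _ (expR (- 2^-1))).
  by rewrite ler_expR lerN2.
rewrite expRN -[leLHS]mul1r ler_pdivrMr ?expR_gt0//.
by have := expR_half_ge R; lra.
Qed.

Lemma expR3_ratio_le : 3 * expR (- 3) <= 16 / 100 :> R.
Proof.
rewrite expRN ler_pdivrMr ?expR_gt0//.
by have := expR3_ge R; lra.
Qed.

Lemma net_opnorm_ge t : 2^-1 <= t -> 14 / 5 <= net_opnorm t.
Proof.
move=> t_ge; have : 69 / 40 <= Num.sqrt (t + 5 / 2).
  rewrite -(ler_pXn2r (ltn0Sn 1)) ?nnegrE ?sqrtr_ge0// ?sqr_sqrtr//; last by lra.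
  by rewrite expr2; lra.
by rewrite /net_opnorm; lra.
Qed.

Lemma net_opnorm_gt0 t : 2^-1 <= t -> 0 < net_opnorm t.
Proof. by move=> /net_opnorm_ge; apply: lt_le_trans; lra. Qed.

Lemma net_mesh_gt0 t : 2^-1 <= t -> 0 < net_mesh t.
Proof.
move=> t_ge; rewrite divr_gt0 ?net_opnorm_gt0// mulr_gt0 ?expR_gt0//; lra.
Qed.

Lemma net_mesh_le t : 2^-1 <= t -> net_mesh t <= 6 / 41.
Proof.
move=> t_ge; rewrite ler_pdivrMr ?net_opnorm_gt0//.
by have := net_opnorm_ge t_ge; have := expRN_le t_ge; lra.
Qed.

(** Writing a and b for the k-th roots of the two net contributions, these are the bounds a + b th
    <= B and b <= B, with th = 3 e^-3 and B = 10 + 8 sqrt t, that [union_bound_net] calls for. *)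
Lemma net_base_le t : 2^-1 <= t ->
  expR 1 * ((net_mesh t)^-1 + 1 + net_mesh t) * expR (- t) +
    expR 1 * (25 + 1 + 25^-1) * expR (- t) * (3 * expR (- 3)) * (3 * expR (- 3))
    <= 10 + 8 * Num.sqrt t /\
  expR 1 * (25 + 1 + 25^-1) * expR (- t) * (3 * expR (- 3)) <= 10 + 8 * Num.sqrt t.
Proof.
move=> t_ge; have gl := expRN_le t_ge; have gg := expR_gt0 (- t).
have tl := expR3_ratio_le.
have tg : 0 < 3 * expR (- 3) :> R by rewrite mulr_gt0 ?expR_gt0.
have e1 := expR1_le R; have e0 : 0 < expR 1 :> R := expR_gt0 1.
have ms := net_mesh_le t_ge; have mg := net_mesh_gt0 t_ge.
have r0 := net_opnorm_gt0 t_ge; have s0 := sqrtr_ge0 t.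
have aE : (net_mesh t)^-1 * expR (- t) = 50 / 33 * net_opnorm t.
  by rewrite /net_mesh; field; rewrite !gt_eqF.
move: aE; set g := expR (- t) in gl gg *; set th := 3 * expR (- 3) in tl tg *.
set eps := net_mesh t in ms mg *; set rho := net_opnorm t in r0 * => aE.
have gth : g * th <= 61 / 100 * (16 / 100) by rewrite ler_pM// ltW.
have gth0 : 0 < g * th by rewrite mulr_gt0.
set b := expR 1 * (25 + 1 + 25^-1) * g * th.
have bE : b = 651 / 25 * (expR 1 * (g * th)) by rewrite /b; field.
have egth : expR 1 * (g * th) <= 11 / 4 * (61 / 100 * (16 / 100)).
  by rewrite ler_pM// ltW.
have b0 : 0 <= b by rewrite !mulr_ge0 // ?ltW//; lra.
have bth : b <= 7 by rewrite bE; lra.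
have -> : expR 1 * (eps^-1 + 1 + eps) * g = expR 1 * (50 / 33 * rho + (1 + eps) * g).
  by rewrite -aE; ring.
have ag : (1 + eps) * g <= 47 / 41 * (61 / 100) by rewrite ler_pM//; lra.
have ag0 : 0 <= (1 + eps) * g by rewrite mulr_ge0//; lra.
have al : expR 1 * (50 / 33 * rho + (1 + eps) * g) <=
    11 / 4 * (50 / 33 * rho + 47 / 41 * (61 / 100)).
  by rewrite ler_pM ?(ltW e0)//; lra.
have bthth : b * th <= 7 * (16 / 100) by rewrite ler_pM// ltW.
split; last by lra.
have rE : rho = 13 / 8 * Num.sqrt (t + 5 / 2) by [].
(* Here 6.78 exceeds (11/4) (50/33) (13/8), and 6.90 is less than what the other two terms leave of
   10. *)
suff : 678 / 100 * Num.sqrt (t + 5 / 2) <= 690 / 100 + 8 * Num.sqrt t.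
  by move: al bthth; rewrite rE; lra.
have t0 : 0 <= t by lra.
have t1 : 0 <= t + 5 / 2 by lra.
have s1 : 7 / 10 <= Num.sqrt t.
  by rewrite -(ler_pXn2r (ltn0Sn 1)) ?nnegrE ?sqr_sqrtr// ?expr2; lra.
have Sq : Num.sqrt t ^+ 2 = t by rewrite sqr_sqrtr.
have Sq' : Num.sqrt (t + 5 / 2) ^+ 2 = t + 5 / 2 by rewrite sqr_sqrtr.
move: Sq Sq' s1; clear.
set s := Num.sqrt t; set s' := Num.sqrt (t + 5 / 2) => sE s'E s1.
have s'0 : 0 <= s' by exact: sqrtr_ge0.
rewrite leNgt; apply/negP => lt_s.
have h1 : 0 < 690 / 100 + 8 * s by lra.
have h2 : (690 / 100 + 8 * s) * (690 / 100 + 8 * s) <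
    678 / 100 * s' * (678 / 100 * s').
  exact: (ltr_pM (ltW h1) (ltW h1) lt_s lt_s).
have h3 : s' * s' = s * s + 5 / 2 by rewrite -[s' * s']expr2 -[s * s]expr2 s'E sE.
have h4 : 0 <= (s - 7 / 10) * (s - 7 / 10) by rewrite -expr2 sqr_ge0.
by move: h2; rewrite [ltRHS]mulrACA h3; lra.
Qed.

(** Of g^l, with g = e^-t, the part g^k is absorbed by the net sizes and g^(l-k) remains. Since l >
    k, th^l <= th^k th, and then a^k + b^k th <= B^(k-1) (a + b th) <= B^k. *)
Lemma union_bound_net t (k l : nat) (n1 n2 : R) : 2^-1 <= t ->
  (0 < k)%N -> (k < l)%N ->
  n1 <= (expR 1 * ((net_mesh t)^-1 + 1 + net_mesh t)) ^+ k ->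
  n2 <= (expR 1 * (25 + 1 + 25^-1)) ^+ k ->
  n1 * (expR (l%:R / 2) * expR (- t) ^+ l) +
    n2 * (3 ^+ l * expR (- ((t + 5 / 2) * l%:R)))
  <= expR (l%:R / 2) * (10 + 8 * Num.sqrt t) ^+ k * expR (- (t * (l%:R - k%:R))).
Proof.
move=> t_ge k0 kl n1le n2le; have [] := net_base_le t_ge.
set g := expR (- t); set th := 3 * expR (- 3); set B := 10 + 8 * _.
set a' := expR 1 * (_ + 1 + _) in n1le *; set b' := expR 1 * _ in n2le *.
set b := b' * g * th; set a := a' * g => abB bB.
have g0 : 0 < g := expR_gt0 _.
have th0 : 0 < th by rewrite mulr_gt0 ?expR_gt0.
have a0 : 0 <= a.
  by rewrite !mulr_ge0 ?expR_ge0 ?(ltW g0)// !addr_ge0 ?invr_ge0// ltW// net_mesh_gt0.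
have b'0 : 0 <= b' by rewrite mulr_ge0 ?expR_ge0//; lra.
have b0 : 0 <= b by rewrite !mulr_ge0// ltW.
have B0 : 0 <= B by exact: le_trans b0 bB.
have gE : expR (- (t * (l%:R - k%:R))) = g ^+ (l - k).
  by rewrite -natrB ?(ltnW kl)// -mulNr expRM_natr.
(* The 5/2 is 3 - 1/2: it yields the same e^(l/2) as the first term and leaves (3 e^-3)^l to beat
   the second net. *)
have E : 3 ^+ l * expR (- ((t + 5 / 2) * l%:R)) =
    expR (l%:R / 2) * g ^+ l * th ^+ l.
  rewrite /g /th exprMn -!expRM_natr mulrCA -!mulrA; congr (_ * _).
  by rewrite -!expRD; congr expR; field.
rewrite E gE {E gE} -!mulrA.
apply: (@le_trans _ _ (expR (l%:R / 2) * (g ^+ (l - k) * (a ^+ k + b ^+ k * th)))).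
  rewrite mulrCA [X in _ + X]mulrCA -mulrDr ler_pM2l ?expR_gt0//.
  have gl : g ^+ l = g ^+ k * g ^+ (l - k) by rewrite -exprD subnKC// ltnW.
  have -> : n1 * g ^+ l + n2 * (g ^+ l * th ^+ l) =
    g ^+ (l - k) * (n1 * g ^+ k + n2 * (g ^+ k * th ^+ l)) by rewrite gl; ring.
  rewrite ler_pM2l ?exprn_gt0// lerD//.
    by rewrite /a exprMn ler_wpM2r// exprn_ge0// ltW.
  have -> : b ^+ k * th = b' ^+ k * (g ^+ k * th ^+ k.+1).
    by rewrite /b [(_ * th) ^+ k]exprMn [(b' * g) ^+ k]exprMn exprSr; ring.
  apply: (@le_trans _ _ (b' ^+ k * (g ^+ k * th ^+ l))).
    by rewrite ler_wpM2r// mulr_ge0// exprn_ge0// ltW.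
  rewrite ler_wpM2l ?exprn_ge0// ler_wpM2l ?exprn_ge0 ?(ltW g0)//.
  rewrite ler_wiXn2l ?(ltW th0)//.
  by apply: le_trans expR3_ratio_le _; lra.
rewrite ler_pM2l ?expR_gt0// mulrC ler_pM2r ?exprn_gt0//.
rewrite -(prednK k0) !exprS.
have pB (x : R) : 0 <= x -> x <= B -> x ^+ k.-1 <= B ^+ k.-1.
  by move=> x0 xB; case: k.-1 => // n; rewrite ler_pXn2r.
have th1 := ltW th0; have aB : a <= B by have := mulr_ge0 b0 th1; lra.
apply: (@le_trans _ _ (a * B ^+ k.-1 + b * B ^+ k.-1 * th)).
  by rewrite lerD// ?ler_wpM2r// ler_wpM2l// pB.
by rewrite [b * _ * th]mulrAC -mulrDl ler_wpM2r// exprn_ge0.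
Qed.

(** m 3^k <= 2^m 3^m = 6^m <= e^(2 m). *)
Lemma row_union_bound (k m : nat) : (k <= m)%N ->
  m%:R * (3 ^+ k * expR (- (4 * m%:R))) <= expR (- (2 * m%:R)) :> R.
Proof.
move=> km.
have -> : expR (- (4 * m%:R)) = expR (- (2 * m%:R)) * expR (- (2 * m%:R)) :> R.
  by rewrite -expRD; congr expR; ring.
rewrite !mulrA -[leRHS]mul1r ler_wpM2r ?expR_ge0//.
rewrite expRN ler_pdivrMr ?expR_gt0// mul1r expRM_natr.
apply: (@le_trans _ _ (6 ^+ m)).
  have -> : 6 = 2 * 3 :> R by ring.
  rewrite exprMn ler_pM ?exprn_ge0//.
    by rewrite -natrX ler_nat ltnW// ltn_expl.
  by rewrite ler_eXn2l//; lra.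
by case: (m) => // n; rewrite ler_pXn2r ?nnegrE ?expR_ge0// expR2_ge.
Qed.

End union_bound_numerics.

(** * Markov's inequality *)

Section markov.
Context (R : realType) (d : measure_display) (T : measurableType d).
Variable P : probability T R.

Lemma integral_sum_seq_le (I : eqType) (J : seq I) (h : I -> T -> R) (c : R) :
  (forall y, measurable_fun setT (h y)) -> (forall y w, 0 <= h y w) ->
  (forall y, y \in J -> (\int[P]_w (h y w)%:E <= c%:E)%E) ->
  (\int[P]_w (\sum_(y <- J) h y w)%:E <= ((size J)%:R * c)%:E)%E.
Proof.
move=> mh h0 hc.
under eq_integral do rewrite -sumEFin.
rewrite ge0_integral_sum//; last 2 first.
- by move=> y; apply/measurable_EFinP.
- by move=> y w _; rewrite lee_fin.
apply: (@le_trans _ _ (\sum_(y <- J) c%:E)%E).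
  by rewrite big_seq [leRHS]big_seq; apply: lee_sum.
by rewrite sumEFin lee_fin big_const_seq count_predT iter_addr_0 mulr_natl.
Qed.

Lemma probability_lt1_ge (W : T -> R) (c : R) : measurable_fun setT W ->
  (forall w, 0 <= W w) -> (\int[P]_w (W w)%:E <= c%:E)%E ->
  ((1 - c)%:E <= P [set w | (W w < 1)%R])%E.
Proof.
move=> mW W0 Wc; set S := [set w | W w < 1].
have mS : measurable S.
  rewrite (_ : S = W @^-1` `]-oo, 1[%classic); last first.
    by apply/seteqP; split => w /=; rewrite in_itv.
  by rewrite -[_ @^-1` _]setTI; exact: mW.
rewrite -[S]setCK probability_setC; last exact: measurableC.
rewrite EFinB leeB//; apply: le_trans Wc.
rewrite -[X in P X]setIT -integral_indic//; last exact: measurableC.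
apply: ge0_le_integral => //.
- exact/measurable_EFinP/measurable_indic/measurableC.
  exact/measurable_EFinP.
move=> w _; rewrite lee_fin indicE; case: (boolP (w \in _)) => // /set_mem.
by rewrite /S /= => /negP; rewrite -leNgt.
Qed.

End markov.

(** * The good event *)

Section good_event.
Context (R : realType) (d : measure_display) (T : measurableType d).
Context (P : probability T R) (m l k : nat) (X : 'I_m * 'I_k -> T -> R).
Context (b : 'I_m -> 'I_l) (v : 'I_m -> R) (t : R).
Hypothesis iidX : iid_std_gaussian P X.
Hypothesis v1 : forall i, \sum_(n | b n == i) v n ^+ 2 = 1.
Hypotheses (k0 : (0 < k)%N) (kl : (k < l)%N) (lm : (l <= m)%N).
Hypothesis t_ge : 2^-1 <= t.

Let E w : 'M[R]_(m, k) := \matrix_(i < m, j < k) X (i, j) w.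
Let V := disjoint_rows_mx b v.
Let Q (y : 'cV[R]_k) w := enorm (V *m E w *m y) ^+ 2.

Let mQ y : measurable_fun setT (Q y).
Proof. exact: (measurable_enorm_sqr_mulmx iidX). Qed.

(** The integrand is below 1 exactly when Q y > r^2 l. Its mean is controlled by (1 + |y|^2 /
    r^2)^(-l/2) <= (r / |y|)^l <= e^(-t l). *)
Let ball_smallness (r : R) (y : 'cV[R]_k) : 0 < r -> r <= expR (- t) * enorm y ->
  (\int[P]_w (expR (l%:R / 2) * expR (- ((2 * r ^+ 2)^-1 * Q y w)))%:E <=
   (expR (l%:R / 2) * expR (- t) ^+ l)%:E)%E.
Proof.
move=> r0 ry.
have yr : 0 <= enorm y ^+ 2 / r ^+ 2 by rewrite divr_ge0// exprn_ge0// ?enorm_ge0// ltW.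
have lamE : 1 + 2 * (2 * r ^+ 2)^-1 * enorm y ^+ 2 = 1 + enorm y ^+ 2 / r ^+ 2.
  by field; rewrite gt_eqF.
under eq_integral do rewrite EFinM.
rewrite ge0_integralZl_EFin ?expR_ge0//; last first.
  apply/measurable_EFinP; apply: measurableT_comp => //.
  by apply: measurableT_comp => //; exact: measurable_funM.
rewrite (mgf_enorm_sqr iidX v1) lamE; last by rewrite ltr_pwDl.
rewrite -EFinM lee_fin ler_pM2l ?expR_gt0//.
apply: lerXn2r; rewrite ?nnegrE ?invr_ge0 ?sqrtr_ge0 ?expR_ge0//.
have sq : enorm y / r <= Num.sqrt (1 + enorm y ^+ 2 / r ^+ 2).
  rewrite -[leLHS]ger0_norm ?divr_ge0 ?enorm_ge0 ?(ltW r0)// -sqrtr_sqr.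
  by rewrite ler_wsqrtr// exprMn exprVn lerDr.
have g0 := expR_gt0 (- t).
rewrite -[leRHS]invrK lef_pV2 ?posrE ?invr_gt0//; last by rewrite sqrtr_gt0 ltr_pwDl.
by apply: le_trans sq; rewrite ler_pdivlMr// ler_pdivrMl.
Qed.

(** The integrand is below 1 exactly when Q y < (9/4) c^2 (t + 5/2) l. *)
Let ball_bigness (c : R) (y : 'cV[R]_k) : 0 < c -> enorm y <= c ->
  (\int[P]_w (expR (- ((t + 5 / 2) * l%:R)) *
      expR (- (- (4 / 9 / c ^+ 2) * Q y w)))%:E <=
   (3 ^+ l * expR (- ((t + 5 / 2) * l%:R)))%:E)%E.
Proof.
move=> c0 yc.
have c2 : 0 < c ^+ 2 by rewrite exprn_gt0.
have yc2 : enorm y ^+ 2 / c ^+ 2 <= 1.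
  by rewrite ler_pdivrMr// mul1r ler_pXn2r ?nnegrE ?enorm_ge0// ltW.
have lamE : 1 + 2 * - (4 / 9 / c ^+ 2) * enorm y ^+ 2 =
    1 - 8 / 9 * (enorm y ^+ 2 / c ^+ 2) by field; rewrite gt_eqF.
have ninth : 9^-1 <= 1 - 8 / 9 * (enorm y ^+ 2 / c ^+ 2) by lra.
under eq_integral do rewrite EFinM.
rewrite ge0_integralZl_EFin ?expR_ge0//; last first.
  apply/measurable_EFinP; apply: measurableT_comp => //.
  by apply: measurableT_comp => //; exact: measurable_funM.
rewrite (mgf_enorm_sqr iidX v1) lamE; last by apply: lt_le_trans ninth; lra.
rewrite -EFinM lee_fin mulrC ler_pM2r ?expR_gt0//.
apply: lerXn2r; rewrite ?nnegrE ?invr_ge0 ?sqrtr_ge0//.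
have n0 : 0 < 1 - 8 / 9 * (enorm y ^+ 2 / c ^+ 2) by apply: lt_le_trans ninth; lra.
rewrite -[leRHS]invrK lef_pV2 ?posrE ?sqrtr_gt0//.
have -> : 3^-1 = Num.sqrt 9^-1 :> R.
  by rewrite -[LHS]ger0_norm// -sqrtr_sqr; congr Num.sqrt; field.
exact: ler_wsqrtr.
Qed.

(** The integrand is below 1 exactly when the squared norm of row [n] is below 9 m. *)
Let row_bigness (n : 'I_m) :
  (\int[P]_w (expR (- (4 * m%:R)) *
      expR (- (- (4 / 9) * \sum_c X (n, c) w ^+ 2)))%:E <=
   (3 ^+ k * expR (- (4 * m%:R)))%:E)%E.
Proof.
have mX q : measurable_fun setT (X q) by have [] := iidX.
under eq_integral do rewrite EFinM.
rewrite ge0_integralZl_EFin ?expR_ge0//; last first.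
  apply/measurable_EFinP; apply: measurableT_comp => //.
  apply: measurableT_comp => //; apply: measurable_funM => //.
  by apply: measurable_sum_seq => c _; exact: measurable_funX.
rewrite (mgf_row_sqr iidX); last by lra.
rewrite -EFinM lee_fin mulrC ler_pM2r ?expR_gt0//.
have -> : 1 + 2 * - (4 / 9) = 3^-1 ^+ 2 :> R by field.
by rewrite sqrtr_sqr gtr0_norm ?invrK//; lra.
Qed.

(* 339/400 = 3/16 + 33/50: on the net the lower threshold is r = 339/400 e^-t,
   and passing to the sphere costs net_opnorm t * net_mesh t = 33/50 e^-t. *)
Lemma good_event : exists S : set T, [/\ measurable S,
  forall w, S w -> (forall n, \sum_c X (n, c) w ^+ 2 <= 9 * m%:R) /\
    forall x, 3 / 16 * expR (- t) * Num.sqrt l%:R * enorm x <=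
      enorm (V *m E w *m x) &
  ((1 - expR (l%:R / 2) * (10 + 8 * Num.sqrt t) ^+ k *
      expR (- (t * (l%:R - k%:R))) - expR (- (2 * m%:R)))%:E <= P S)%E].
Proof.
have g0 := expR_gt0 (- t).
have tg := t_ge; have e0 := net_mesh_gt0 t_ge; have e1 := net_mesh_le t_ge.
have [N1 [cov1 _ sN1]] := euclidean_net k0 e0.
have [|N2 [cov2 bN2 sN2]] := @euclidean_net R k 25^-1 k0; first by lra.
pose J1 := [seq y <- N1 | 1 - net_mesh t <= enorm y].
pose r := 339 / 400 * expR (- t).
have r0 : 0 < r by apply: mulr_gt0; [lra|exact: g0].
pose c : R := 1 + 25^-1.
have c0 : 0 < c by rewrite /c; lra.
pose h1 y w := expR (l%:R / 2) * expR (- ((2 * r ^+ 2)^-1 * Q y w)).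
pose h2 y w := expR (- ((t + 5 / 2) * l%:R)) * expR (- (- (4 / 9 / c ^+ 2) * Q y w)).
pose h3 n w := expR (- (4 * m%:R)) * expR (- (- (4 / 9) * \sum_c X (n, c) w ^+ 2)).
have mX q : measurable_fun setT (X q) by have [] := iidX.
have mh1 y : measurable_fun setT (h1 y).
  apply: measurable_funM => //; apply: measurableT_comp => //.
  by apply: measurableT_comp => //; exact: measurable_funM.
have mh2 y : measurable_fun setT (h2 y).
  apply: measurable_funM => //; apply: measurableT_comp => //.
  by apply: measurableT_comp => //; exact: measurable_funM.
have mh3 n : measurable_fun setT (h3 n).
  apply: measurable_funM => //; apply: measurableT_comp => //.
  apply: measurableT_comp => //; apply: measurable_funM => //.
  by apply: measurable_sum_seq => j _; exact: measurable_funX.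
have h10 y w : 0 <= h1 y w by rewrite mulr_ge0 ?expR_ge0.
have h20 y w : 0 <= h2 y w by rewrite mulr_ge0 ?expR_ge0.
have h30 n w : 0 <= h3 n w by rewrite mulr_ge0 ?expR_ge0.
pose W1 w := \sum_(y <- J1) h1 y w.
pose W2 w := \sum_(y <- N2) h2 y w.
pose W3 w := \sum_(n <- index_enum 'I_m) h3 n w.
have mW1 : measurable_fun setT W1 by apply: measurable_sum_seq.
have mW2 : measurable_fun setT W2 by apply: measurable_sum_seq.
have mW3 : measurable_fun setT W3 by apply: measurable_sum_seq.
have W10 w : 0 <= W1 w by apply: sumr_ge0.
have W20 w : 0 <= W2 w by apply: sumr_ge0.
have W30 w : 0 <= W3 w by apply: sumr_ge0.
have W1_le y w : y \in J1 -> h1 y w <= W1 w.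
  by move=> yJ; rewrite /W1 (big_rem y)//= lerDl sumr_ge0.
have W2_le y w : y \in N2 -> h2 y w <= W2 w.
  by move=> yJ; rewrite /W2 (big_rem y)//= lerDl sumr_ge0.
have W3_le n w : h3 n w <= W3 w by rewrite /W3 (bigD1 n)//= lerDl sumr_ge0.
pose W w := W1 w + W2 w + W3 w.
have mW : measurable_fun setT W.
  by apply: measurable_funD => //; exact: measurable_funD.
exists [set w | W w < 1]; split.
- rewrite (_ : mkset _ = W @^-1` `]-oo, 1[%classic); last first.
    by apply/seteqP; split => w /=; rewrite in_itv.
  by rewrite -[_ @^-1` _]setTI; exact: mW.
- move=> w; rewrite /= /W => Ww; have [w1 w2 w3] := And3 (W10 w) (W20 w) (W30 w).
  have [W1w W2w W3w] : [/\ W1 w < 1, W2 w < 1 & W3 w < 1] by split; lra.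
  split=> [n|].
    have : h3 n w < 1 by apply: le_lt_trans (W3_le n w) _.
    rewrite /h3 -expRD expR_lt1; lra.
  have c2E : (c * (3 / 2 * Num.sqrt (t + 5 / 2)) * Num.sqrt l%:R) ^+ 2 =
      c ^+ 2 * (9 / 4) * ((t + 5 / 2) * l%:R).
    rewrite [LHS]exprMn [(c * _) ^+ 2]exprMn [(3 / 2 * _) ^+ 2]exprMn.
    rewrite [Num.sqrt l%:R ^+ 2]sqr_sqrtr// [Num.sqrt (t + _) ^+ 2]sqr_sqrtr.
      by field.
    by move: t_ge; lra.
  have op x : enorm (V *m E w *m x) <= net_opnorm t * Num.sqrt l%:R * enorm x.
    (* Origin of the 13/8: it is (26/25) (3/2) / (1 - 1/25), where 26/25 bounds the points of the
       net and 3/2 comes from the parameter 4/9. *)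
    have -> : net_opnorm t * Num.sqrt l%:R =
        c * (3 / 2 * Num.sqrt (t + 5 / 2)) * Num.sqrt l%:R / (1 - 25^-1).
      by rewrite /net_opnorm /c; field.
    apply: opnorm_net cov2 _ _; [lra|lra|move=> y yN].
    have : h2 y w < 1 by apply: le_lt_trans (W2_le y w yN) _.
    rewrite /h2 -expRD expR_lt1 mulNr opprK addrC subr_lt0 => H.
    rewrite -(ler_pXn2r (ltn0Sn 1)) ?nnegrE ?enorm_ge0//; last first.
      by rewrite !mulr_ge0 ?sqrtr_ge0 ?(ltW c0).
    rewrite c2E -/(Q y w).
    have c20 : 0 < c ^+ 2 by rewrite exprn_gt0.
    have -> : Q y w = c ^+ 2 * (9 / 4) * (4 / 9 / c ^+ 2 * Q y w).
      by field; rewrite gt_eqF.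
    by rewrite ler_pM2l ?(ltW H)// mulr_gt0//; lra.
  have -> : 3 / 16 * expR (- t) * Num.sqrt l%:R =
     r * Num.sqrt l%:R - net_opnorm t * Num.sqrt l%:R * net_mesh t.
    by rewrite /net_mesh /r; field; rewrite gt_eqF// net_opnorm_gt0.
  apply: min_singular_value_net cov1 _ op _.
    by rewrite mulr_ge0 ?sqrtr_ge0// ltW// net_opnorm_gt0.
  move=> y yN y1; have yJ : y \in J1 by rewrite mem_filter y1.
  have : h1 y w < 1 by apply: le_lt_trans (W1_le y w yJ) _.
  rewrite /h1 -expRD expR_lt1 subr_lt0 => H.
  rewrite -(ler_pXn2r (ltn0Sn 1)) ?nnegrE ?enorm_ge0//; last first.
    by rewrite mulr_ge0 ?sqrtr_ge0// ltW.
  have r20 : 0 < r ^+ 2 by rewrite exprn_gt0.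
  rewrite exprMn [X in _ * X]sqr_sqrtr// -/(Q y w).
  have -> : Q y w = 2 * r ^+ 2 * ((2 * r ^+ 2)^-1 * Q y w).
    by field; rewrite gt_eqF.
  have -> : r ^+ 2 * l%:R = 2 * r ^+ 2 * (l%:R / 2) by field.
  by rewrite ler_pM2l ?(ltW H)// mulr_gt0.
rewrite -addrA -opprD; apply: probability_lt1_ge => // [w|].
  by rewrite /W !addr_ge0.
under eq_integral do rewrite EFinD EFinD.
rewrite ge0_integralD//; last 4 first.
- by move=> w _; rewrite -EFinD lee_fin addr_ge0.
- by apply: emeasurable_funD; exact/measurable_EFinP.
- by move=> w _; rewrite lee_fin.
- exact/measurable_EFinP.
rewrite ge0_integralD//; last 4 first.
- by move=> w _; rewrite lee_fin.
- exact/measurable_EFinP.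
- by move=> w _; rewrite lee_fin.
- exact/measurable_EFinP.
rewrite EFinD; apply: leeD.
  apply: (@le_trans _ _ (((size J1)%:R * (expR (l%:R / 2) * expR (- t) ^+ l))%:E +
      ((size N2)%:R * (3 ^+ l * expR (- ((t + 5 / 2) * l%:R))))%:E)%E).
    apply: leeD; apply: integral_sum_seq_le => // y yJ.
      apply: ball_smallness => //; move: yJ; rewrite mem_filter => /andP[y1 _].
      (* 339/400 < 35/41 = 1 - 6/41 <= 1 - net_mesh t <= |y|. *)
      by rewrite /r mulrC ler_pM2l//; lra.
    by apply: ball_bigness => //; exact: bN2.
  rewrite -EFinD lee_fin; apply: union_bound_net => //.
    by apply: le_trans sN1; rewrite ler_nat size_filter count_size.
  by apply: le_trans sN2 _; rewrite invrK.
apply: (@le_trans _ _ (((size (index_enum 'I_m))%:R *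
    (3 ^+ k * expR (- (4 * m%:R))))%:E)).
  by apply: integral_sum_seq_le => // n _; exact: row_bigness.
have -> : size (index_enum 'I_m) = m by rewrite -[RHS]card_ord cardE/= enumT.
by rewrite lee_fin row_union_bound// ltnW// (leq_trans kl).
Qed.

End good_event.

(** * Distortion *)

(* beta = L p / (p + 1) makes beta / (L - beta) = p and
   (L / beta) ^ p = (1 + 1 / p) ^ p < e. *)
Lemma beta_distortion_lt (R : realType) (m l p L : nat) (g beta : R) :
  (0 < p)%N -> (0 < l)%N -> (0 < L)%N -> (p * l <= m)%N -> 0 < g ->
  beta = L%:R * p%:R / (p%:R + 1) ->
  Num.sqrt l%:R * (beta ^- p.-1 * (3 * Num.sqrt m%:R / (L%:R - beta))) /
    (3 / 16 * g * Num.sqrt l%:R) <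
  16 * expR 1 * m%:R `^ (3 / 2) * l%:R^-1 * (L%:R ^- p / g).
Proof.
move=> p0 l0 L0 plm g0 betaE.
have pR : 0 < (p%:R : R) by rewrite ltr0n.
have lR : 0 < l%:R :> R by rewrite ltr0n.
have LR : 0 < L%:R :> R by rewrite ltr0n.
have m0 : (0 < m)%N by apply: leq_trans plm; rewrite muln_gt0 p0.
have mR : 0 < m%:R :> R by rewrite ltr0n.
have sl : 0 < Num.sqrt l%:R :> R by rewrite sqrtr_gt0.
have sm : 0 < Num.sqrt m%:R :> R by rewrite sqrtr_gt0.
have p1 : 0 < p%:R + 1 :> R by rewrite addr_gt0.
have b0 : 0 < beta by rewrite betaE divr_gt0 ?mulr_gt0.
have LbE : L%:R - beta = L%:R / (p%:R + 1).
  by rewrite betaE; field; rewrite gt_eqF.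
have bE : beta ^- p.-1 / (L%:R - beta) = (1 + p%:R^-1) ^+ p * p%:R * L%:R ^- p.
  have -> : beta ^- p.-1 = beta * beta ^- p.
    rewrite -{2}(prednK p0) exprS invfM mulrA divff ?mul1r// gt_eqF//.
  have -> : beta ^- p = (1 + p%:R^-1) ^+ p * L%:R ^- p.
    rewrite -!exprVn -exprMn; congr (_ ^+ _).
    by rewrite betaE; field; rewrite !gt_eqF.
  rewrite LbE; set u := (1 + _) ^+ p; set z := L%:R ^- p.
  by rewrite betaE; field; rewrite !gt_eqF.
have -> : m%:R `^ (3 / 2) = m%:R * Num.sqrt m%:R :> R.
  have -> : 3 / 2 = 1 + 2^-1 :> R by field.
  by rewrite powRD ?powRr1 ?powR12_sqrt ?ler0n// gt_eqF ?implybT.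
have u_lt : (1 + p%:R^-1) ^+ p < expR 1 :> R.
  rewrite -[in ltRHS](divff (lt0r_neq0 pR)) mulrC expRM_natr.
  rewrite ltr_pXn2r ?nnegrE ?expR_ge0 ?addr_ge0 ?invr_ge0 ?(ltW pR)//.
  by rewrite expR_gt1Dx// invr_eq0 gt_eqF.
have u0 : 0 <= (1 + p%:R^-1) ^+ p :> R by rewrite exprn_ge0// addr_ge0// invr_ge0 ltW.
set u := (1 + _) ^+ p in bE u_lt u0 *; set z := L%:R ^- p in bE *.
have z0 : 0 < z by rewrite invr_gt0 exprn_gt0.
have -> : Num.sqrt l%:R * (beta ^- p.-1 * (3 * Num.sqrt m%:R / (L%:R - beta))) /
    (3 / 16 * g * Num.sqrt l%:R) =
    16 * (Num.sqrt m%:R * z / g) * (u * p%:R).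
  have -> : beta ^- p.-1 * (3 * Num.sqrt m%:R / (L%:R - beta)) =
    3 * Num.sqrt m%:R * (beta ^- p.-1 / (L%:R - beta)) by ring.
  by rewrite bE; field; rewrite !gt_eqF.
have -> : 16 * expR 1 * (m%:R * Num.sqrt m%:R) * l%:R^-1 * (z / g) =
    16 * (Num.sqrt m%:R * z / g) * (expR 1 * (m%:R / l%:R)) by field; rewrite !gt_eqF.
rewrite ltr_pM2l; last by rewrite mulr_gt0// divr_gt0// mulr_gt0.
apply: (@lt_le_trans _ _ (expR 1 * p%:R)); first by rewrite ltr_pM2r.
by rewrite ler_pM2l ?expR_gt0// ler_pdivlMr// -natrM ler_nat.
Qed.

Section distortion.
Context (R : realType) (m l' k L : nat) (t : R).
Let l := l'.+1.
Let p := (m %/ l)%N.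
Let beta : R := L%:R * p%:R / (p%:R + 1).

(** By Cauchy-Schwarz, rows of norm at most 3 sqrt m keep the coordinates of E x below 3 sqrt m on
    the unit ball, which fixes [mu] in [Da_le]. *)
Lemma Da_lt (E : 'M[R]_(m, k)) : (l <= m)%N -> (0 < L)%N ->
  (forall n, \sum_c E n c ^+ 2 <= 9 * m%:R) ->
  (forall x, 3 / 16 * expR (- t) * Num.sqrt l%:R * enorm x <=
     enorm (disjoint_rows_mx (beta_block l' p) (beta_weight l' p beta) *m E *m x)) ->
  (Da E L < (16 * expR 1 * m%:R `^ (3 / 2) * l%:R^-1 *
    (L%:R ^- p / expR (- t)))%:E)%E.
Proof.
move=> lm L0 rows sing.
have p0 : (0 < p)%N by rewrite divn_gt0.
have plm : (p * l <= m)%N by exact: leq_trunc_div.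
have lpm : (l * p <= m)%N by rewrite mulnC.
have m0 : 0 < (m%:R : R) by rewrite ltr0n (leq_trans _ lm).
have LR : 0 < (L%:R : R) by rewrite ltr0n.
have pR : 0 < (p%:R : R) by rewrite ltr0n.
have p1 : 0 < p%:R + 1 :> R by rewrite addr_gt0.
have mu0 : 0 < 3 * Num.sqrt (m%:R : R) by apply: mulr_gt0; rewrite ?sqrtr_gt0; lra.
apply: le_lt_trans (Da_le p0 lpm L0 _ _ mu0 _ _ sing) _.
- by apply: divr_gt0 => //; exact: mulr_gt0.
- by rewrite ltr_pdivrMr// ltr_pM2l// ltrDl.
- by do 2 (apply: mulr_gt0; rewrite ?expR_gt0 ?sqrtr_gt0 ?ltr0n//); lra.
- move=> x x1 n; rewrite -(ler_pXn2r (ltn0Sn 1)) ?nnegrE ?(ltW mu0)//.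
  rewrite real_normK ?num_real// mxE.
  have -> : \sum_j E n j * x j 0 = \sum_j (row n E)^T j 0 * x j 0.
    by apply: eq_bigr => j _; rewrite !mxE.
  apply: le_trans (cauchy_schwarz_sqr _ _) _.
  rewrite exprMn [Num.sqrt m%:R ^+ 2]sqr_sqrtr ?ler0n// -[leRHS]mulr1.
  rewrite ler_pM ?sqr_ge0//; last by rewrite exprn_ile1 ?enorm_ge0.
  have -> : 3 ^+ 2 = 9 :> R by ring.
  by rewrite enorm_sqr; under eq_bigr do rewrite !mxE; exact: rows.
rewrite lte_fin; apply: beta_distortion_lt => //; exact: expR_gt0.
Qed.

End distortion.

Theorem theorem4 (R : realType) (d : measure_display) (T : measurableType d)
    (P : probability T R) (m l k L : nat)
    (X : 'I_m * 'I_k -> T -> R) (eta : R) :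
  (k < l)%N -> (l <= m)%N -> (2 <= L)%N -> ((m < 2 * l)%N -> (2 < L)%N) ->
  iid_std_gaussian P X ->
  0 < eta -> eta < 1 - ((m %/ l)%:R * (L%:R - 1))^-1 ->
  exists S : set T,
    [/\ measurable S,
        S `<=` [set w | (Da (\matrix_(i < m, j < k) X (i, j) w) L <
            (16 * expR 1 * m%:R `^ (3 / 2) * l%:R^-1 *
             L%:R `^ (- ((1 - eta) * (m %/ l)%:R)))%:E)%E] &
        ((1 - expR (l%:R / 2)
              * (10 + 8 * Num.sqrt (eta * (m %/ l)%:R * ln L%:R)) ^+ k
              * expR (eta / (1 - eta) * (l%:R - k%:R))
              * L%:R `^ (- (eta * (m %/ l)%:R * (l%:R - k%:R)))
            - expR (- (2 * m%:R)))%:E <= P S)%E].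
Proof.
case: l => [//|l']; set l := l'.+1 => kl lm L2 _ iidX eta0 eta_lt.
set p := (m %/ l)%N in eta_lt *.
have L0 : (0 < L)%N by apply: leq_trans L2.
have LR : 0 < (L%:R : R) by rewrite ltr0n.
have L1 : 1 <= (L%:R : R) by rewrite ler1n.
have p0 : (0 < p)%N by rewrite divn_gt0.
have lpm : (l * p <= m)%N by rewrite mulnC leq_trunc_div.
have eta1 : eta < 1.
  apply: lt_le_trans eta_lt _; rewrite lerBlDr lerDl invr_ge0 mulr_ge0//.
  by rewrite subr_ge0.
(* With this t, L^(-(1 - eta) p) = L^-p e^t and L^(-eta p (l - k)) = e^(-t (l - k)). *)
set t := eta * p%:R * ln L%:R.
have kl0 : 0 <= l%:R - k%:R :> R by rewrite subr_ge0 ler_nat ltnW.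
have t0 : 0 <= t by rewrite !mulr_ge0 ?(ltW eta0)// ln_ge0.
have powE x : L%:R `^ x = expR (x * ln L%:R) :> R by rewrite /powR gt_eqF.
have -> : L%:R `^ (- ((1 - eta) * p%:R)) = L%:R ^- p / expR (- t) :> R.
  rewrite powE -expRN opprK -[L%:R in RHS]lnK ?posrE// -expRM_natl -expRN -expRD.
  by congr expR; rewrite /t; ring.
have -> : L%:R `^ (- (eta * p%:R * (l%:R - k%:R))) = expR (- (t * (l%:R - k%:R))) :> R.
  by rewrite powE; congr expR; rewrite /t; ring.
set B := 10 + 8 * Num.sqrt t.
have B1 : 1 <= B by rewrite /B; have := sqrtr_ge0 t; lra.
have c1 : 1 <= expR (eta / (1 - eta) * (l%:R - k%:R)).
  by rewrite -[leLHS]expR0 ler_expR mulr_ge0// divr_ge0 ?(ltW eta0)// subr_ge0 ltW.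
set c := expR (eta / _ * _) in c1 *.
set q := expR (l%:R / 2) * B ^+ k * expR (- (t * (l%:R - k%:R))).
have q0 : 0 <= q by rewrite !mulr_ge0 ?expR_ge0// exprn_ge0// (le_trans _ B1).
have -> : expR (l%:R / 2) * B ^+ k * c * expR (- (t * (l%:R - k%:R))) = c * q.
  by rewrite /q; ring.
have qc : q <= c * q by rewrite ler_peMl.
have e2m := expR_ge0 (- (2 * m%:R) : R).
(* For t < 1/2 the claimed lower bound is nonpositive. *)
have [t_lt|t_ge] := ltP t 2^-1.
  exists set0; split => //; rewrite measure0 lee_fin.
  have q1 : 1 <= q.
    rewrite /q mulrAC -expRD -[leLHS]mul1r ler_pM//; last first.
      by rewrite exprn_ege1.
    rewrite -[leLHS]expR0 ler_expR subr_ge0.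
    apply: le_trans (_ : t * l%:R <= _); first by rewrite ler_wpM2l// lerBlDr lerDl.
    by rewrite mulrC ler_wpM2l// ltW.
  by lra.
pose beta : R := L%:R * p%:R / (p%:R + 1).
(* The net requires k > 0. For k = 0 the matrix has no columns, and every outcome satisfies the
   hypotheses of [Da_lt]. *)
have [k0|k0] := posnP k.
  have no_ord (i : 'I_k) : False by case: i => i; rewrite k0.
  exists setT; split => // [w _|].
    apply: (@Da_lt R m l' k L t) => // [n|x].
      by rewrite big1 ?mulr_ge0// => c' _; case: (no_ord c').
    have -> : x = 0 by apply/matrixP => i; case: (no_ord i).
    by rewrite mulmx0 !enorm0 mulr0.
  by rewrite probability_setT lee_fin; move: q0 qc e2m; clear; lra.
have [S [mS Sgood PS]] :=
  good_event iidX (beta_weight_unit p0 lpm beta) k0 kl lm t_ge.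
exists S; split => // [w Sw|].
  have [rows sing] := Sgood w Sw.
  apply: (@Da_lt R m l' k L t) => // n.
  by under eq_bigr do rewrite mxE; exact: rows.
by apply: le_trans PS; rewrite lee_fin -/q; lra.
Qed.
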